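(* Let $Q(\mathbf n)=\sum_{j=1}^d\theta_j n_j^2$ be the quadratic form of an irrational torus of dimension $d\ge 2$, with associated linear Schrödinger evolution $e^{-it\Delta}$ on $\mathbb{T}^d$, and let $I\subset\mathbb{R}$ be a compact interval. (i) The scaling-invariant Strichartz estimate $$\|e^{-it\Delta}f\|_{L^p_{t,\mathbf x}(I\times\mathbb{T}^d)}\lesssim N^{\frac d2-\frac{d+2}{p}}\|f\|_{L^2(\mathbb{T}^d)}$$ holds for all $N\ge 1$ and all $f\in L^2(\mathbb{T}^d)$ with $\operatorname{supp}\widehat f\subset[-N,N]^d$, provided that $d$ and $p$ are in one of the following ranges: (i.a) $d=2$ and $p>\frac{20}{3}$; (i.b) $d=3$ and $p>\frac{16}{3}$; (i.c) $d=4$ and $p>4$; (i.d) $d\ge 5$ and $p\ge 4$. (ii) Let $\varepsilon>0$. Then the estimate with an $\varepsilon$-loss $$\|e^{-it\Delta}f\|_{L^p_{t,\mathbf x}(I\times\mathbb{T}^d)}\lesssim N^{\frac d2-\frac{d+2}{p}+\varepsilon}\|f\|_{L^2(\mathbb{T}^d)}$$ holds for all $N\ge 1$ and all $f\in L^2(\mathbb{T}^d)$ with $\operatorname{supp}\widehat f\subset[-N,N]^d$, provided that $d$ and $p$ are in one of the following ranges: (ii.a) $d=2$ and $p\ge\frac{20}{3}$; (ii.b) $d=3$ and $p=\frac{16}{3}$; (ii.c) $d=4$ and $p=4$.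
   Context: $\mathbb{T}^d=(\mathbb{R}/\mathbb{Z})^d$ and $\widehat f(\mathbf n)=\int_{\mathbb{T}^d}f(\mathbf x)e^{-2\pi i\mathbf n\cdot\mathbf x}\,d\mathbf x$ for $\mathbf n\in\mathbb{Z}^d$. The irrational torus is $\prod_{j=1}^d\mathbb{R}/(\alpha_j\mathbb{Z})$ with $\alpha_j>0$, where at least one $\alpha_j$ cannot be written as a linear combination of the other $\alpha_k$'s with rational coefficients. After rescaling each coordinate to $\mathbb{T}^d$ it is encoded by the form $$Q(\mathbf n)=\theta_1n_1^2+\cdots+\theta_dn_d^2,\qquad \tfrac1C\le\theta_j=\alpha_j^{-2}\le C,\quad j=1,\dots,d,$$ for some constant $C\geq 1$. The linear evolution is $$e^{-it\Delta}f(\mathbf x)=\sum_{\mathbf n\in\mathbb{Z}^d}\widehat f(\mathbf n)e^{2\pi i(\mathbf n\cdot\mathbf x+Q(\mathbf n)t)}.$$ $A\lesssim B$ means $A\le C'B$ for a constant $C'>0$ independent of $N$ and $f$; the implicit constants depend on $d$, $p$, $C$, the length of $I$, and, in (ii), on $\varepsilon$. *)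

(* Defs.v *)
From HB Require Import structures.
From mathcomp Require Import all_boot all_order all_algebra.
From mathcomp Require Import complex.
From mathcomp Require Import all_classical all_reals all_analysis.

Set Implicit Arguments.
Unset Strict Implicit.
Unset Printing Implicit Defensive.

Import Order.TTheory GRing.Theory Num.Theory.
Import numFieldNormedType.Exports.

Local Open Scope classical_set_scope.
Local Open Scope ring_scope.
Local Open Scope complex_scope.

(* [measurableTypeR R] is R with its Borel sigma-algebra, in the presentation
   on which [lebesgue_measure] and [uniform_prob] are defined. *)
Definition Rd (R : realType) (d : nat) := d.-tuple (measurableTypeR R).
HB.instance Definition _ (R : realType) (d : nat) :=
  Measurable.copy (Rd R d) (d.-tuple (measurableTypeR R)).

Section cons_tuple.
Context (R : realType) (d : nat).

Definition cons_Rd (z : measurableTypeR R * Rd R d) : Rd R d.+1 :=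
  [tuple of z.1 :: z.2].

Lemma measurable_cons_Rd :
  measurable_fun [set: measurableTypeR R * Rd R d] cons_Rd.
Proof. exact: measurable_cons. Qed.

HB.instance Definition _ :=
  isMeasurableFun.Build _ _ _ _ cons_Rd measurable_cons_Rd.

End cons_tuple.

(* The torus T^d = (R/Z)^d is represented by the unit cube: functions on T^d
   are Z^d-periodic functions on R^d, and the Lebesgue measure of T^d is the
   d-fold product of the Lebesgue measure of [0, 1], seen as a measure on R^d
   carried by [0, 1]^d. *)
Fixpoint torus_measure (R : realType) (d : nat) : probability (Rd R d) R :=
  match d with
  | 0 => dirac ([tuple] : Rd R 0)
  | d'.+1 =>
      distribution (uniform_prob (@ltr01 R) \x torus_measure R d')%E
        (@cons_Rd R d')
  end.

Section torus.
Context (R : realType) (d : nat).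
Implicit Types (x : Rd R d) (n : d.-tuple int) (f : Rd R d -> R[i]).

Definition expi2pi (y : R) : R[i] := cos (2 * pi * y) +i* sin (2 * pi * y).

Definition cintegral d' (T : measurableType d')
    (mu : {measure set T -> \bar R}) (g : T -> R[i]) : R[i] :=
  (\int[mu]_x complex.Re (g x)) +i* (\int[mu]_x complex.Im (g x)).

Definition cLnorm d' (T : measurableType d')
    (mu : {measure set T -> \bar R}) (p : R) (g : T -> R[i]) : \bar R :=
  Lnorm mu p%:E (fun y => (Normc.normc (g y))%:E).

Definition periodic f :=
  forall x n, f [tuple (tnth x j : R) + (tnth n j)%:~R | j < d] = f x.

Definition cmeasurable f :=
  measurable_fun setT (fun x => complex.Re (f x)) /\
  measurable_fun setT (fun x => complex.Im (f x)).

Definition L2_torus f :=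
  [/\ periodic f, cmeasurable f & (cLnorm (torus_measure R d) 2 f < +oo)%E].

Definition dotZ n x : R := \sum_(j < d) (tnth n j)%:~R * (tnth x j : R).

Definition fourier f n : R[i] :=
  cintegral (torus_measure R d) (fun x => f x * expi2pi (- dotZ n x)).

Definition fourier_supp_in f (N : R) :=
  forall n, fourier f n != 0 -> forall j, `|(tnth n j)%:~R| <= N.

Definition irrational_torus (alpha : 'I_d -> R) :=
  (forall j, 0 < alpha j) /\
  exists j, ~ exists q : 'I_d -> rat,
    alpha j = \sum_(k < d | k != j) ratr (q k) * alpha k.

Definition theta (alpha : 'I_d -> R) (j : 'I_d) : R := (alpha j) ^- 2.

Definition qform (alpha : 'I_d -> R) n : R :=
  \sum_(j < d) theta alpha j * (tnth n j)%:~R ^+ 2.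

(* The sum over Z^d is the finitely-supported sum of the library: it has its
   intended value when only finitely many Fourier coefficients of f are
   nonzero, in particular when the Fourier support of f is bounded. *)
Definition evolution (alpha : 'I_d -> R) f (t : R) x : R[i] :=
  \sum_(n \in [set: d.-tuple int])
    fourier f n * expi2pi (dotZ n x + qform alpha n * t).

Definition spacetime_measure (a b : R) :
    {measure set (measurableTypeR R * Rd R d) -> \bar R} :=
  (mrestr (@lebesgue_measure R) (measurable_itv `[a, b]%R)
     \x torus_measure R d)%E.

End torus.

(* ||e^{-it Delta} f||_{L^p(I x T^d)} <= K N^s ||f||_{L^2(T^d)} with K depending
   only on d, on the bound C for the theta_j, on the length L of I, on p and
   on s. *)
Definition strichartz (R : realType) (d : nat) (C L p s : R) : Prop :=
  exists2 K : R, 0 < K &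
    forall alpha : 'I_d -> R,
      irrational_torus alpha ->
      (forall j, C^-1 <= theta alpha j <= C) ->
    forall a : R,
    forall N : R, 1 <= N ->
    forall f : Rd R d -> R[i],
      L2_torus f -> fourier_supp_in f N ->
      (cLnorm (spacetime_measure d a (a + L)) p
         (fun z => evolution alpha f z.1 z.2)
       <= (K * N `^ s)%:E * cLnorm (torus_measure R d) 2 f)%E.

(* Main.v *)
From HB Require Import structures.
Require Import Defs.
From mathcomp Require Import all_boot all_order all_algebra.
From mathcomp Require Import complex.
From mathcomp Require Import all_classical all_reals all_analysis.
From mathcomp Require Import measurable_realfun.
From mathcomp Require Import ring lra zify.

Set Implicit Arguments.
Unset Strict Implicit.
Unset Printing Implicit Defensive.

Import Order.TTheory GRing.Theory Num.Theory.
Import numFieldNormedType.Exports.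

Local Open Scope ring_scope.
Local Open Scope complex_scope.

(** The evolution of a function with Fourier support in [[-N, N]^d] is a finite
    exponential sum [u(t, x) = sum_n c_n e(n x + Q(n) t)], and the idea is to
    bound the superlevel sets [E = {|u| > lam}] by a [T T^*] argument. Let
    [Y] be the integral of [|u|^2] over [E] and [A^2 >= sum |c_n|^2].
    Pairing [u] with [v = 1_E conj u] and using Cauchy-Schwarz in [n] gives
      [Y^2 <= A^2 int int (sum_n V_n(t) conj (V_n(s))) dt ds],
    where [V_n(t)] is, up to a phase, a Fourier coefficient of [v(t, .)].
    The inner sum has two bounds. It is at most [D(t - s) a(t) a(s)], where
    [a(t)] is the integral of [|v(t, .)|] and [D(t)] is the supremum over [x] of
    the kernel [|sum_n e(n x + Q(n) t)|]; and by Bessel it is at most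
    [(b(t) + b(s)) / 2], where [b(t)] is the integral of [|v(t, .)|^2].
    Using the first bound where [D(t - s) <= H = lam^2 / (2 A^2)] and the second
    elsewhere, and [lam int a <= Y = int b], one half of [Y^2] is absorbed
    and there remains [Y <= 2 A^2 m], where [m] bounds the measure of
    [{D > H}] ([level_set_le]).

    So everything is reduced to the measure of the set of times at which the
    kernel is large. The kernel is a product over the coordinates of quadratic
    Weyl sums of length [n = 2 N + 1], evaluated at the times [theta_j t]. By
    Weyl differencing, if the square of such a sum exceeds [y], then either [y]
    is at most [n] up to a small power, its size at a generic time, or the time
    is close to a rational with a denominator [q <= 4 n^2 / y], within about
    [n^-2 (n^2 / (q y))^2] ([weyl_level]). Adding the lengths of these arcs,
    the measure of the set is [O(y^-rho n^(2 rho - 2))] for every [rho > 2]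
    ([weyl_cover]), without loss in [n]. The [theta_j] enter
    only through the change of variable from [t] to [theta_j t]. Hence
    [m = O(H^(- 2 rho / d) n^(2 rho - 2))] ([kernel_cover]).

    Summing over dyadic heights [lam] up to [sup |u| <= A n^(d / 2)]
    ([dyadic_layers_le]), the layers form a geometric series dominated by the
    largest height as soon as [4 rho / d < p - 2], and the result is the
    scaling-invariant bound. A suitable [rho > 2] exists when [d (p - 2) > 8],
    that is [p > 2 + 8 / d]; this covers all the ranges but
    [d = 4, p = 4], which follows from an exponent slightly above 4
    since time and space have finite measure. *)

Local Notation normc := Normc.normc.
(* In [ring_scope] the star otherwise denotes the conjugation of closed
   fields, which is a different constant. *)
Local Notation "z ^*" := (conjc z) : ring_scope.

(** * The modulus of complex numbers *)

Section complex_norm.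
Context {R : realType}.
Implicit Types z w : R[i].

Lemma normc_ge0 z : 0 <= normc z.
Proof. by case: z => a b; rewrite /= sqrtr_ge0. Qed.

Lemma sqr_normcE z : normc z ^+ 2 = complex.Re z ^+ 2 + complex.Im z ^+ 2.
Proof. by case: z => a b /=; rewrite sqr_sqrtr// addr_ge0// sqr_ge0. Qed.

Lemma mulcJ z : z * z^* = ((normc z ^+ 2)%:C : R[i]).
Proof.
rewrite sqr_normcE; case: z => a b; apply/eqP; rewrite eq_complex /=.
by apply/andP; split; apply/eqP; ring.
Qed.

Lemma conjcM z w : (z * w)^* = z^* * w^*.
Proof. exact: (rmorphM (@conjc R)). Qed.

Lemma normc_conjc z : normc z^* = normc z.
Proof. by case: z => a b /=; rewrite sqrrN. Qed.

Lemma normc_real (a : R) : normc (a%:C : R[i]) = `|a|.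
Proof. by rewrite /= expr0n addr0 sqrtr_sqr. Qed.

Lemma normcM z w : normc (z * w) = normc z * normc w.
Proof. exact: Normc.normcM. Qed.

Lemma ler_normcD z w : normc (z + w) <= normc z + normc w.
Proof. exact: le_normcD. Qed.

Lemma ler_normc_sum (I : Type) (r : seq I) (P : pred I) (F : I -> R[i]) :
  normc (\sum_(i <- r | P i) F i) <= \sum_(i <- r | P i) normc (F i).
Proof.
elim/big_rec2: _ => [|i x y _ xy]; first by rewrite Normc.normc0.
by rewrite (le_trans (ler_normcD _ _))// lerD2l.
Qed.

Lemma normr_Re_le z : `|complex.Re z| <= normc z.
Proof.
rewrite -(ler_pXn2r (n:=2)) ?nnegrE ?normc_ge0// sqr_normcE real_normK ?num_real//.
by rewrite lerDl sqr_ge0.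
Qed.

Lemma normr_Im_le z : `|complex.Im z| <= normc z.
Proof.
rewrite -(ler_pXn2r (n:=2)) ?nnegrE ?normc_ge0// sqr_normcE real_normK ?num_real//.
by rewrite lerDr sqr_ge0.
Qed.

Lemma cReD z w : complex.Re (z + w) = complex.Re z + complex.Re w.
Proof. by case: z => a b; case: w => c e. Qed.

Lemma cImD z w : complex.Im (z + w) = complex.Im z + complex.Im w.
Proof. by case: z => a b; case: w => c e. Qed.

Lemma cReM z w : complex.Re (z * w) =
  complex.Re z * complex.Re w - complex.Im z * complex.Im w.
Proof. by case: z => a b; case: w => c e. Qed.

Lemma cImM z w : complex.Im (z * w) =
  complex.Re z * complex.Im w + complex.Im z * complex.Re w.
Proof. by case: z => a b; case: w => c e. Qed.

Lemma cRe_sum (I : Type) (r : seq I) (P : pred I) (F : I -> R[i]) :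
  complex.Re (\sum_(i <- r | P i) F i) = \sum_(i <- r | P i) complex.Re (F i).
Proof. by elim/big_rec2: _ => // i x y _ <-; rewrite cReD. Qed.

End complex_norm.

(** * The character e(t) = exp (2 i pi t) *)
Section expi.
Context {R : realType}.
Local Notation e := (@expi2pi R).

Lemma expi2piD a b : e (a + b) = e a * e b.
Proof.
apply/eqP; rewrite eq_complex /expi2pi /= mulrDr cosD sinD.
by apply/andP; split; apply/eqP; ring.
Qed.

Lemma expi2pi0 : e 0 = 1.
Proof. by rewrite /expi2pi mulr0 cos0 sin0. Qed.

Lemma expi2piN a : e (- a) = (e a)^*.
Proof. by rewrite /expi2pi mulrN cosN sinN. Qed.

Lemma normc_expi2pi a : normc (e a) = 1.
Proof. by rewrite /= cos2Dsin2 sqrtr1. Qed.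

Lemma expi2pi1 : e 1 = 1.
Proof. by rewrite /expi2pi mulr1 mulr_natl cos2pi sin2pi. Qed.

Lemma expi2piMn a n : e (n%:R * a) = e a ^+ n.
Proof.
elim: n => [|n IH]; first by rewrite mul0r expi2pi0.
by rewrite -natr1 mulrDl mul1r expi2piD IH exprSr.
Qed.

Lemma expi2pi_int (m : int) : e m%:~R = 1.
Proof.
have en n : e n%:R = 1 by rewrite -[n%:R]mulr1 expi2piMn expi2pi1 expr1n.
case: m => n; first exact: en.
by rewrite NegzE mulrNz expi2piN en conjc1.
Qed.

Lemma expi2piDz a (m : int) : e (a + m%:~R) = e a.
Proof. by rewrite expi2piD expi2pi_int mulr1. Qed.

Lemma expi2pi_sum (I : Type) (r : seq I) (P : pred I) (F : I -> R) :
  e (\sum_(i <- r | P i) F i) = \prod_(i <- r | P i) e (F i).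
Proof.
elim/big_rec2: _ => [|i x y _ <-]; first exact: expi2pi0.
by rewrite expi2piD.
Qed.

(** Concavity of the sine would give the constant 2/pi; the mean value theorem
    on half the angle, where the cosine is at least [cos (pi / 4)], gives 1/2,
    which is enough. *)
Lemma sin_ge_half (x : R) : 0 <= x <= pi / 2 -> x / 2 <= sin x.
Proof.
move=> /andP[x0 xpi].
have [u xu] : exists u, x = u *+ 2 by exists (x / 2); lra.
have -> : x / 2 = u by rewrite xu; lra.
have u0 : 0 <= u by lra.
have upi : u <= pi / 4 by lra.
rewrite {}xu {x x0 xpi}.
have c4 : cos (pi / 4 : R) ^+ 2 = 1 / 2.
  have : cos ((pi / 4 : R) *+ 2) = 0 by rewrite -[RHS](@cos_pihalf R); congr cos; lra.
  by rewrite cos_mulr2n => H; lra.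
have cu v : 0 <= v <= pi / 4 -> cos (pi / 4 : R) <= cos v.
  move=> /andP[v0 v4]; have pi0 := pi_gt0 R.
  by rewrite leNgt ltr_cos ?in_itv/= -?leNgt//; lra.
have p4 : 0 <= cos (pi / 4 : R).
  by apply: cos_ge0_pihalf; have := pi_gt0 R; lra.
have su : u * cos (pi / 4) <= sin u.
  have := u0; rewrite le_eqVlt => /orP[/eqP <-|u0']; first by rewrite mul0r sin0.
  have [c] := @MVT R sin cos 0 u u0' (fun z _ => is_derive_sin z)
    (continuous_subspaceT (@continuous_sin R)).
  rewrite in_itv/= sin0 !subr0 => /andP[c0 cuu] ->.
  by rewrite mulrC ler_wpM2r// cu//; lra.
rewrite sin_mulr2n mulr2n.
have := cu u; rewrite u0 upi => /(_ isT) cuu.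
have : u * cos (pi / 4) * cos (pi / 4) <= sin u * cos u.
  apply: ler_pM => //; exact: mulr_ge0.
by rewrite -mulrA -expr2 c4; lra.
Qed.

(** Here [t * (1 - t)] stands for the distance from [t] to the integers. *)
Lemma normc_expi2piB1 (t : R) : 0 <= t <= 1 ->
  2 * (t * (1 - t)) <= normc (e t - 1).
Proof.
move=> /andP[t0 t1].
have -> : normc (e t - 1) = 2 * sin (pi * t).
  have s0 : 0 <= sin (pi * t :> R).
    apply: sin_ge0_pi; have := pi_gt0 R => ?.
    by rewrite mulr_ge0 ?(ltW (pi_gt0 R))//= -[leRHS]mulr1 ler_pM2l.
  apply/eqP; rewrite -(eqrXn2 (n:=2)) ?normc_ge0 ?mulr_ge0// sqr_normcE.
  rewrite /expi2pi -[2 * pi * t]mulrA mulr_natl cos_mulr2n sin_mulr2n.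
  have := cos2Dsin2 (pi * t); move: (cos _) (sin _) => c s cs /=.
  have c2 : c ^+ 2 = 1 - s ^+ 2 by rewrite -cs; ring.
  apply/eqP; rewrite subr0 c2; ring: c2.
rewrite ler_pM2l//; have pi2 := pi_ge2 R; have pi0 := pi_gt0 R.
have [th|th] := leP t (1 / 2).
  have : pi * t / 2 <= sin (pi * t).
    by apply: sin_ge_half; rewrite mulr_ge0 ?(ltW pi0)//= ler_pM2l//; lra.
  apply: le_trans; have : 0 <= (pi - 2) * t by rewrite mulr_ge0//; lra.
  nra.
have : pi * (1 - t) / 2 <= sin (pi * (1 - t)).
  apply: sin_ge_half; rewrite mulr_ge0 ?(ltW pi0)//= ?ler_pM2l//; lra.
rewrite mulrBr mulr1 sinB sinpi cospi mul0r sub0r mulN1r opprK.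
apply: le_trans.
have : 0 <= (pi - 2) * (1 - t) by rewrite mulr_ge0//; lra.
nra.
Qed.

(** A geometric sum is at most the inverse of the distance from [x] to the
    integers. Adding the inverse distances to the integers on both sides of [x]
    avoids asking which one is nearer. *)
Lemma normc_geom_sum (x t : R) (b : int) (m : nat) :
  x = t + b%:~R -> 0 < t < 1 ->
  normc (\sum_(0 <= l < m) e (x * l%:R)) <= t^-1 + (1 - t)^-1.
Proof.
move=> -> /andP[t0 t1].
have tt : 0 < t * (1 - t) by rewrite mulr_gt0// subr_gt0.
have -> : t^-1 + (1 - t)^-1 = (t * (1 - t))^-1.
  have h1 : 1 - t != 0 by rewrite gt_eqF// subr_gt0.
  have h2 : t != 0 by rewrite gt_eqF.
  by field; rewrite h1 h2.
rewrite -[leRHS]mul1r ler_pdivlMr//.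
under eq_bigr do rewrite mulrC expi2piMn expi2piDz.
rewrite big_mkord.
rewrite -(ler_pM2l (ltr0n R 2)) mulr1 mulrCA.
have tt' : 0 <= t <= 1 by rewrite !ltW.
apply: le_trans (ler_wpM2l (normc_ge0 _) (normc_expi2piB1 tt')) _.
rewrite -normcM mulrC -subrX1 (le_trans (ler_normcD _ _))//.
by rewrite normcN Normc.normc1 -expi2piMn normc_expi2pi.
Qed.

End expi.

(** * Power sums *)
Section power_sums.
Context {R : realType}.

(** Telescoping: [a * (k+2)^-(1+a) <= (k+1)^-a - (k+2)^-a], which is
    [exp x >= 1 + x] for [x = a * ln ((k+2)/(k+1)) >= a / (k+2)]. *)
Lemma sum_powRN_le (a : R) (n : nat) : 0 < a ->
  \sum_(0 <= k < n) (k.+1%:R : R) `^ (- (1 + a)) <= 1 + a^-1.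
Proof.
move=> a0.
have step (k : nat) : a * (k.+2%:R : R) `^ (- (1 + a)) <=
    (k.+1%:R : R) `^ (- a) - (k.+2%:R : R) `^ (- a).
  have k1 : 0 < (k.+1%:R : R) by rewrite ltr0n.
  have k2 : 0 < (k.+2%:R : R) by rewrite ltr0n.
  rewrite opprD powRD; last by apply/implyP => _; rewrite gt_eqF.
  rewrite powR_inv1 ?ler0n//.
  have -> : (k.+1%:R : R) `^ (- a) =
      expR (a * ln (k.+2%:R / k.+1%:R)) * (k.+2%:R : R) `^ (- a).
    rewrite /powR !gt_eqF// -expRD ln_div ?posrE//; congr expR; ring.
  rewrite -[X in _ <= _ - X]mul1r -mulrBl mulrA ler_wpM2r ?powR_ge0//.
  rewrite lerBrDl (le_trans _ (expR_ge1Dx _))// lerD2l ler_wpM2l ?(ltW a0)//.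
  have : ln (k.+1%:R / k.+2%:R : R) <= k.+1%:R / k.+2%:R - 1.
    rewrite lerBrDl; apply: le_trans (expR_ge1Dx _) _.
    by rewrite lnK// posrE divr_gt0.
  rewrite !ln_div ?posrE// => H.
  have -> : k.+2%:R^-1 = - (k.+1%:R / k.+2%:R - 1) :> R.
    have e2 : (k.+2%:R : R) = k.+1%:R + 1 by rewrite natr1.
    move: (k.+1%:R : R) (k.+2%:R : R) k2 e2 => u v v0 vu.
    have vn : v != 0 by rewrite gt_eqF.
    have -> : u = v - 1 by lra.
    by field.
  move: H; set x := _ / _ - 1. by lra.
have tele m : a * \sum_(0 <= k < m) (k.+2%:R : R) `^ (- (1 + a)) <=
    1 - (m.+1%:R : R) `^ (- a).
  elim: m => [|m IH]; first by rewrite big_geq// mulr0 powR1 subrr.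
  by rewrite big_nat_recr//= mulrDr; have := step m; lra.
case: n => [|n]; first by rewrite big_geq// addr_ge0// invr_ge0 ltW.
rewrite big_nat_recl//= powR1 lerD2l -(ler_pM2l a0) divff ?gt_eqF//.
by apply: le_trans (tele n) _; rewrite gerBl powR_ge0.
Qed.

Lemma sum_inv_sqrt_le (n : nat) :
  \sum_(0 <= j < n) (Num.sqrt (j.+1%:R : R))^-1 <= 2 * Num.sqrt n%:R.
Proof.
elim: n => [|n IH]; first by rewrite big_geq// mulr_ge0 ?sqrtr_ge0.
rewrite big_nat_recr//=; apply: le_trans (lerD IH (lexx _)) _.
set a := Num.sqrt n%:R; set b := Num.sqrt n.+1%:R.
have a2 : a ^+ 2 = n%:R by rewrite sqr_sqrtr.
have b2 : b ^+ 2 = n%:R + 1 by rewrite sqr_sqrtr// natr1.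
have b0 : 0 < b by rewrite sqrtr_gt0 ltr0n.
have a0 : 0 <= a by rewrite sqrtr_ge0.
rewrite -(ler_pM2l b0) mulrDr divff ?gt_eqF//.
by have := sqr_ge0 (b - a); nra.
Qed.

End power_sums.

(** * Weyl differencing and Dirichlet approximation *)
Section weyl.
Context {R : realType}.
Local Notation e := (@expi2pi R).

Lemma conjc_sum (I : Type) (r : seq I) (P : pred I) (F : I -> R[i]) :
  (\sum_(i <- r | P i) F i)^* = \sum_(i <- r | P i) (F i)^*.
Proof. exact: (rmorph_sum (@conjc R)). Qed.

(** In the expanded square, the pairs of indices are grouped according to their
    difference [h]. *)
Lemma sqr_normc_sum (z : nat -> R[i]) (n : nat) :
  (forall k, normc (z k) = 1) ->
  normc (\sum_(0 <= k < n) z k) ^+ 2 =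
  n%:R + 2 * complex.Re (\sum_(1 <= h < n) \sum_(0 <= l < n - h)
    z (l + h)%N * (z l)^*).
Proof.
move=> z1; elim: n => [|n IH].
  by rewrite !big_geq// Normc.normc0 expr0n/= mulr0 addr0.
have normc2D (x y : R[i]) : normc (x + y) ^+ 2 =
    normc x ^+ 2 + normc y ^+ 2 + 2 * complex.Re (y * x^*).
  by rewrite !sqr_normcE; case: x => a b; case: y => c d /=; ring.
rewrite big_nat_recr//= normc2D IH z1 expr1n -natr1.
have -> : \sum_(1 <= h < n.+1) \sum_(0 <= l < n.+1 - h) z (l + h)%N * (z l)^* =
   \sum_(1 <= h < n) \sum_(0 <= l < n - h) z (l + h)%N * (z l)^* +
   z n * (\sum_(0 <= l < n) z l)^*.
  have -> : \sum_(1 <= h < n) \sum_(0 <= l < n - h) z (l + h)%N * (z l)^* =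
      \sum_(1 <= h < n.+1) \sum_(0 <= l < n - h) z (l + h)%N * (z l)^*.
    case: n {IH} => [|n]; first by rewrite !big_geq.
    by rewrite [RHS]big_nat_recr//= subnn [X in _ + X]big_geq// addr0.
  rewrite [X in _ + X](_ : _ = \sum_(1 <= h < n.+1) z n * (z (n - h)%N)^*).
    rewrite -big_split/=; apply: eq_big_nat => h /andP[h1 hn].
    by rewrite subSn// big_nat_recr//= subnK.
  rewrite conjc_sum mulr_sumr big_nat_rev/= big_add1/=.
  by apply: eq_big_nat => h hn; rewrite add0n.
by rewrite cReD; ring.
Qed.

(** Multiplying the [k + h]-th term by the conjugate of the [k]-th leaves a phase
    that is linear in [k], with a slope that does not depend on [y]: the
    resulting bound is uniform in [y]. *)
Lemma weyl_differencing (y s : R) (n : nat) :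
  normc (\sum_(0 <= k < n) e (k%:R * y + k%:R ^+ 2 * s)) ^+ 2 <=
  n%:R + 2 * \sum_(1 <= h < n)
    normc (\sum_(0 <= l < n - h) e ((h%:R * (2 * s)) * l%:R)).
Proof.
rewrite sqr_normc_sum => [|k]; last exact: normc_expi2pi.
rewrite lerD2l ler_wpM2l// cRe_sum; apply: ler_sum_nat => h _.
apply: le_trans (ler_norm _) _; apply: le_trans (normr_Re_le _) _.
rewrite [X in normc X](_ : _ = e (h%:R * y + h%:R ^+ 2 * s) *
    \sum_(0 <= l < n - h) e (h%:R * (2 * s) * l%:R)).
  by rewrite normcM normc_expi2pi mul1r.
rewrite mulr_sumr; apply: eq_bigr => l _.
by rewrite -expi2piN -!expi2piD; congr e; rewrite natrD; ring.
Qed.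

(** Two of the fractional parts of [0, x, .., Q x] lie in the same interval of
    length [1 / Q]; removing the common factor of [a] and [q] only improves the
    approximation. *)
Lemma dirichlet (x : R) (Q : nat) : (0 < Q)%N ->
  exists q : nat, exists a : int,
    [/\ (0 < q <= Q)%N, coprime `|a| q & `|q%:R * x - a%:~R| <= Q%:R^-1].
Proof.
move=> Q0; have Q0' : 0 < (Q%:R : R) by rewrite ltr0n.
pose fr (q : nat) := q%:R * x - (Num.floor (q%:R * x))%:~R.
have fr01 q : 0 <= fr q < 1.
  by rewrite /fr subr_ge0 floor_le/= ltrBlDl -[1]/(1%:~R) -intrD floorD1_gt.
pose F (i : 'I_Q.+1) : nat := Num.truncn (Q%:R * fr i).
have FQ i : (F i < Q)%N.
  have /andP[f0 f1] := fr01 i.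
  rewrite /F -(ltr_nat R); apply: le_lt_trans (_ : Q%:R * fr i < _).
    by rewrite truncn_le mulr_ge0// ltW.
  by rewrite -[ltRHS]mulr1 ltr_pM2l.
have /injectivePn[i [j ij Fij]] : ~~ injectiveb (fun i => Ordinal (FQ i)).
  apply/injectiveP => /leq_card; rewrite !card_ord ltnn//.
have {Fij}Fij : F i = F j by case: Fij.
wlog : i j ij Fij / (i < j)%N.
  move=> H; have := ij; rewrite neq_ltn => /orP[|] ji; first exact: (H i j).
  by apply: (H j i); rewrite // eq_sym.
move=> {}ij.
pose q := (j - i)%N; pose a := Num.floor (j%:R * x) - Num.floor (i%:R * x).
have q0 : (0 < q)%N by rewrite subn_gt0.
have qQ : (q <= Q)%N by rewrite (leq_trans (leq_subr _ _))// -ltnS.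
have qa : `|q%:R * x - a%:~R| <= Q%:R^-1.
  have -> : q%:R * x - a%:~R = fr j - fr i.
    by rewrite /q /a /fr natrB ?(ltnW ij)// intrB; ring.
  have /andP[fi0 fi1] := fr01 i; have /andP[fj0 fj1] := fr01 j.
  rewrite -(ler_pM2l Q0') divff ?gt_eqF// -[X in X * _ <= _](gtr0_norm Q0') -normrM.
  have bd k : (F k)%:R <= Q%:R * fr k < (F k).+1%:R.
    by apply: truncn_itv; have /andP[? _] := fr01 k; rewrite mulr_ge0// ltW.
  have := bd i; have := bd j; rewrite Fij => /andP[j1 j2] /andP[i1 i2].
  by rewrite ler_norml -natr1 in j2 i2 *; lra.
pose g := gcdn `|a| q; have g0 : (0 < g)%N by rewrite gcdn_gt0 q0 orbT.
exists (q %/ g)%N, (a %/ g)%Z.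
have gq : (g %| q)%N by rewrite dvdn_gcdr.
have ga : (g %| a)%Z by rewrite /dvdz /=; exact: dvdn_gcdl.
split.
- by rewrite divn_gt0// dvdn_leq//= (leq_trans (leq_div _ _)).
- rewrite /coprime; have -> : `|(a %/ g)%Z|%N = (`|a| %/ g)%N.
    by rewrite -{2}(divzK ga) abszM/= mulnK.
  by rewrite -(eqn_pmul2l g0) muln_gcdr muln1 !(mulnC g) !divnK// ?dvdn_gcdl.
- have gR : 1 <= (g%:R : R) by rewrite ler1n.
  have e1 : q%:R * x - a%:~R = g%:R * ((q %/ g)%:R * x - (a %/ g)%Z%:~R).
    rewrite mulrBr mulrA -natrM mulnC divnK// -[g%:R]/((g%:Z)%:~R) -intrM.
    by rewrite [_ * (a %/ _)%Z]mulrC divzK.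
  apply: le_trans qa; rewrite e1 normrM ger0_norm ?(le_trans ler01)//.
  by rewrite ler_peMl.
Qed.

End weyl.

(** * Differenced sums near a rational point *)
Section residues.
Context {R : realType}.
Local Notation e := (@expi2pi R).

Lemma big_nat_blocks (G : nat -> R) (m q : nat) :
  \sum_(0 <= h < m * q) G h = \sum_(0 <= i < m) \sum_(0 <= r < q) G (i * q + r)%N.
Proof.
elim: m => [|m IH]; first by rewrite mul0n !big_geq.
rewrite big_nat_recr//= -IH (@big_cat_nat _ _ _ (m * q))//=; last first.
  by rewrite leq_mul2r leqnSn orbT.
congr (_ + _); rewrite -[X in \sum_(X <= _ < _) _]add0n big_addn mulSn addnK.
by apply: eq_bigr => r _; rewrite addnC.
Qed.

(** Multiplication by [a] permutes the residues modulo [q]. *)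
Lemma sum_coprime_residues (W : nat -> R) (a q : nat) : (0 < q)%N ->
  coprime a q ->
  \sum_(0 <= r < q) W (r * a %% q)%N = \sum_(0 <= r < q) W r.
Proof.
move=> q0 aq; rewrite !big_mkord.
pose f (r : 'I_q) := Ordinal (ltn_pmod (r * a) q0).
have f_inj : injective f.
  move=> r s /(congr1 val)/= /eqP.
  wlog : r s / (s <= r)%N => [H|sr].
    by have [sr|/ltnW rs] := leqP s r; [exact: H|rewrite eq_sym => /(H _ _ rs)].
  rewrite eqn_mod_dvd ?leq_mul2r ?sr ?orbT// -mulnBl Gauss_dvdl 1?coprime_sym//.
  have rsq : (r - s < q)%N by rewrite (leq_ltn_trans (leq_subr _ _)).
  move=> /dvdnP[k rsk]; apply: val_inj; apply/eqP; rewrite eqn_leq sr andbT.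
  rewrite -subn_eq0 rsk; case: k rsk => // k rsk.
  by move: rsq; rewrite rsk mulSn ltnNge leq_addr.
by rewrite [RHS](reindex_inj f_inj).
Qed.

(** The harmonic sum costs only an arbitrarily small power. *)
Lemma sum_inv_le_powR (a : R) (q N : nat) : 0 < a -> (q <= N)%N ->
  \sum_(0 <= r < q) (r%:R : R)^-1 <= (1 + a^-1) * N%:R `^ a.
Proof.
move=> a0 qN; case: q qN => [|q] qN.
  by rewrite big_geq// mulr_ge0 ?powR_ge0// addr_ge0// invr_ge0 ltW.
rewrite big_nat_recl//= invr0 add0r.
apply: (@le_trans _ _ (N%:R `^ a * \sum_(0 <= k < q) k.+1%:R `^ (- (1 + a)))).
  rewrite mulr_sumr; apply: ler_sum_nat => r /andP[_ rq].
  have r0 : 0 < (r.+1%:R : R) by rewrite ltr0n.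
  rewrite opprD powRD; last by apply/implyP => _; rewrite gt_eqF.
  rewrite powR_inv1 ?ler0n// mulrCA ler_peMr ?invr_ge0//.
  rewrite powRN ler_pdivlMr ?powR_gt0// mul1r.
  by apply: ge0_ler_powR; rewrite ?nnegrE ?ler0n ?(ltW a0)// ler_nat (leq_trans _ qN)// ltnW.
by rewrite mulrC ler_wpM2r ?powR_ge0// sum_powRN_le.
Qed.

End residues.

Section major_arc.
Context {R : realType}.
Local Notation e := (@expi2pi R).

Variables (n q : nat) (a : int) (x : R).
Hypotheses (n0 : (0 < n)%N) (q0 : (0 < q)%N) (q2n : (q <= 2 * n)%N).
Hypotheses (aq : coprime `|a| q) (xa : `|q%:R * x - a%:~R| <= (2 * n)%:R^-1).

(* [T h] is the differenced sum with difference [h]. If [q] does not divide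
   [h], it is governed by the residue [r] of [h * a] modulo [q], through [W r];
   if [h = q * j], it is governed by the distance [j * `|g|]. *)
Let g : R := q%:R * x - a%:~R.
Let T (h : nat) : R := normc (\sum_(0 <= l < n - h) e ((h%:R * x) * l%:R)).
Let W (r : nat) : R := if r == 0%N then 0 else 2 * q%:R / r%:R + 2 * q%:R / (q%:R - r%:R).
Let a' : nat := `|(a %% q)%Z|%N.

Let qR : 0 < (q%:R : R). Proof. by rewrite ltr0n. Qed.
Let nR : 0 < (n%:R : R). Proof. by rewrite ltr0n. Qed.

Lemma normc_diff_sum_le_size h : T h <= n%:R.
Proof.
rewrite /T; apply: le_trans (ler_normc_sum _ _ _) _.
under eq_bigr do rewrite normc_expi2pi.
by rewrite sumr_const_nat subn0 ler_nat leq_subr.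
Qed.

Let diff_close h : (h < n)%N -> h%:R * `|g| <= 2^-1.
Proof.
move=> hn; apply: le_trans (ler_wpM2l (ler0n _ h) xa) _.
rewrite natrM invfM mulrA ler_pdivrMr// mulrC ler_pM2l ?invr_gt0//.
by rewrite ler_nat ltnW.
Qed.

(** The point [q * j * x] is at distance [j * `|g|] from the integer [j * a],
    and this distance is at most 1/2. *)
Lemma diff_sum_multiple j : (0 < j)%N -> (q * j < n)%N -> g != 0 ->
  T (q * j) <= 2 / (j%:R * `|g|).
Proof.
move=> j0 jn gn0.
have jR : 0 < (j%:R : R) by rewrite ltr0n.
have g0 : 0 < `|g| by rewrite normr_gt0.
have jg : j%:R * `|g| <= 2^-1.
  by apply: diff_close; rewrite (leq_ltn_trans _ jn)// leq_pmull.
set t := j%:R * `|g|; have t0 : 0 < t by rewrite mulr_gt0.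
have bound : t^-1 + (1 - t)^-1 <= 2 / t.
  have : (1 - t)^-1 <= t^-1 by rewrite lef_pV2 ?posrE//; rewrite -/t in jg; lra.
  by rewrite mulr_natl mulr2n; lra.
have t1 : 0 < t < 1 by rewrite t0 -/t/= in jg *; lra.
have [gp|gm] := ltrP 0 g.
  apply: le_trans bound; apply: (normc_geom_sum (b := (j%:Z * a))%R) => //.
  by rewrite /t gtr0_norm// /g natrM intrM/=; ring.
apply: le_trans bound.
have -> : t^-1 + (1 - t)^-1 = (1 - t)^-1 + (1 - (1 - t))^-1.
  by rewrite subKr addrC.
apply: (normc_geom_sum (b := (j%:Z * a - 1))%R).
  by rewrite /t ler0_norm// /g natrM intrB intrM/=; ring.
by lra.
Qed.

(** Modulo 1, [h * x] is [r / q + h * g / q]: the error [h * g / q] is at most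
    [1 / (2 * q)], hence at most half of the distance from [r / q] to either of
    the integers 0 and 1. *)
Lemma diff_sum_nonmultiple h : (h < n)%N -> ~~ (q %| h)%N ->
  T h <= W (h * a' %% q).
Proof.
move=> hn qh; set r := (h * a' %% q)%N.
have a'E : (a %% q)%Z = a'%:Z by rewrite /a' gez0_abs// modz_ge0// eqz_nat -lt0n.
have a'q : coprime a' q.
  have : coprimez (a %% q)%Z q by rewrite /coprimez gcdz_modl; exact: aq.
  by rewrite coprimezE.
have r0 : (0 < r)%N.
  rewrite lt0n; apply: contra qh => r0.
  by rewrite -(@Gauss_dvdl q h a')// coprime_sym.
have rq : (r < q)%N by rewrite ltn_mod.
rewrite /W gtn_eqF//.
pose b : int := (h%:Z * (a %/ q)%Z + ((h * a') %/ q)%N%:Z)%R.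
have hab : h%:R * a%:~R = q%:R * b%:~R + r%:R :> R.
  have aE : a%:~R = (a %/ q)%Z%:~R * q%:R + a'%:R :> R.
    by rewrite {1}(divz_eq a q) a'E intrD intrM.
  have ha : h%:R * a'%:R = ((h * a') %/ q)%N%:R * q%:R + r%:R :> R.
    by rewrite -!natrM -natrD -divn_eq.
  rewrite aE mulrDr ha /b intrD intrM/=; ring.
have hg := diff_close hn.
have /ler_normlP[hg1 hg2] : `|h%:R * g| <= 2^-1 by rewrite normrM ger0_norm.
have rR : 1 <= (r%:R : R) by rewrite ler1n.
have rqR : (r%:R : R) + 1 <= q%:R by rewrite natr1 ler_nat.
pose t := (h%:R * g + r%:R) / q%:R.
have qt : q%:R * t = h%:R * g + r%:R by rewrite /t mulrC divfK ?gt_eqF.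
have t0 : r%:R / (2 * q%:R) <= t.
  by rewrite ler_pdivrMr ?mulr_gt0// mulrC -mulrA qt; lra.
have t1 : (q%:R - r%:R) / (2 * q%:R) <= 1 - t.
  by rewrite ler_pdivrMr ?mulr_gt0// mulrC -mulrA mulrBr mulr1 qt; lra.
have t0' : 0 < t by apply: lt_le_trans t0; rewrite divr_gt0 ?mulr_gt0//; lra.
have t1' : 0 < 1 - t by apply: lt_le_trans t1; rewrite divr_gt0 ?mulr_gt0//; lra.
apply: le_trans (_ : t^-1 + (1 - t)^-1 <= _).
  apply: (normc_geom_sum (b := b)); last by lra.
  have qn : (q%:R : R) != 0 by rewrite gt_eqF.
  apply: (mulfI qn).
  by rewrite mulrDr qt /g; move: hab; lra.
rewrite -[2 * _ / r%:R]invf_div -[2 * _ / (_ - _)]invf_div.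
by apply: lerD; rewrite lef_pV2 ?posrE// divr_gt0 ?mulr_gt0//; lra.
Qed.

Let W_ge0 r : (r < q)%N -> 0 <= W r.
Proof.
move=> rq; rewrite /W; case: ifP => // _.
by rewrite addr_ge0// divr_ge0 ?mulr_ge0// subr_ge0 ler_nat ltnW.
Qed.

Let sum_W (b : R) : 0 < b ->
  \sum_(0 <= r < q) W r <= 4 * q%:R * ((1 + b^-1) * (2 * n)%:R `^ b).
Proof.
move=> b0; pose I := \sum_(0 <= r < q) (r%:R : R)^-1.
apply: (@le_trans _ _ (4 * q%:R * I)); last first.
  by rewrite ler_pM2l ?mulr_gt0// sum_inv_le_powR.
have I2 : \sum_(1 <= r < q) (q%:R - r%:R : R)^-1 = \sum_(1 <= r < q) (r%:R)^-1.
  rewrite [RHS]big_nat_rev/=; apply: eq_big_nat => r /andP[r1 rq].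
  by rewrite add1n subSS natrB// ltnW.
have -> : I = \sum_(1 <= r < q) (r%:R : R)^-1 by rewrite /I big_ltn// invr0 add0r.
have -> : \sum_(0 <= r < q) W r = \sum_(1 <= r < q) W r.
  by rewrite big_ltn// /W eqxx add0r.
rewrite [leLHS](_ : _ = \sum_(1 <= r < q)
    (2 * q%:R * r%:R^-1 + 2 * q%:R * (q%:R - r%:R)^-1)).
  by rewrite big_split/= -!mulr_sumr I2; lra.
by apply: eq_big_nat => r /andP[r1 rq]; rewrite /W gtn_eqF.
Qed.

(** The differences [h] that are not multiples of [q] contribute no more than at
    a generic point, that is [n] up to a small power. The bound [F] for the
    multiples is left free because the trivial bound and the bound by the
    inverse distance are both needed. *)
Lemma sum_diff_le (F : nat -> R) (b : R) : 0 < b ->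
  (forall j, 0 <= F j) ->
  (forall j, (0 < j)%N -> (q * j < n)%N -> T (q * j) <= F j) ->
  \sum_(1 <= h < n) T h <= \sum_(1 <= j < (n %/ q).+1) F j +
    12 * n%:R * ((1 + b^-1) * (2 * n)%:R `^ b).
Proof.
move=> b0 F0 TF; set m := (n %/ q).+1; set Z := (1 + b^-1) * _.
have Z0 : 0 <= Z by rewrite mulr_ge0 ?powR_ge0// addr_ge0// invr_ge0 ltW.
have a'q : coprime a' q.
  have : coprimez (a %% q)%Z q by rewrite /coprimez gcdz_modl; exact: aq.
  by rewrite coprimezE.
pose B h : R := if (q %| h)%N then (if h == 0%N then 0 else F (h %/ q)%N)
                else W (h * a' %% q)%N.
have B0 h : 0 <= B h.
  by rewrite /B; case: ifP => _; [case: ifP|rewrite W_ge0// ltn_mod].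
apply: (@le_trans _ _ (\sum_(0 <= h < m * q) B h)).
  apply: (@le_trans _ _ (\sum_(1 <= h < n) B h)).
    apply: ler_sum_nat => h /andP[h0 hn]; rewrite /B; case: ifPn => qh.
      rewrite gtn_eqF// -{1}(divnK qh) mulnC; apply: TF.
        by rewrite divn_gt0// dvdn_leq.
      by rewrite mulnC divnK.
    exact: diff_sum_nonmultiple.
  have nm : (n <= m * q)%N by rewrite ltnW// -ltn_divLR.
  rewrite (@big_cat_nat _ _ _ n 0 (m * q))//= (big_ltn n0).
  by rewrite -addrA [leRHS]addrC -addrA lerDl addr_ge0// sumr_ge0.
rewrite big_nat_blocks.
apply: (@le_trans _ _ (\sum_(0 <= i < m) ((if i == 0%N then 0 else F i) + 4 * q%:R * Z))).
  apply: ler_sum_nat => i _.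
  apply: le_trans (lerD (lexx _) (sum_W b0)).
  rewrite -(sum_coprime_residues W q0 a'q).
  have bl (G : nat -> R) : \sum_(0 <= r < q) G r = G 0%N + \sum_(1 <= r < q) G r.
    exact: big_ltn.
  rewrite !bl mul0n mod0n addn0 [W 0%N]/W eqxx add0r; apply: lerD.
    by rewrite /B dvdn_mull// muln_eq0 (gtn_eqF q0) orbF mulnK.
  apply: ler_sum_nat => r /andP[r0 rq].
  rewrite /B dvdn_addr ?dvdn_mull// gtnNdvd//.
  by rewrite mulnDl -mulnA [(q * _)%N]mulnC mulnA modnMDl.
rewrite big_split/= sumr_const_nat subn0 big_ltn//= add0r.
apply: lerD.
  by rewrite le_eqVlt; apply/orP; left; apply/eqP; apply: eq_big_nat => j /andP[j0 _]; rewrite gtn_eqF.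
have mq : m%:R * q%:R <= 3 * n%:R :> R.
  rewrite -!natrM ler_nat /m mulSn.
  have : (n %/ q * q <= n)%N := leq_trunc_div _ _.
  lia.
rewrite -mulr_natr; have := ler_wpM2r Z0 mq; lra.
Qed.

End major_arc.

(** * Superlevel sets of quadratic Weyl sums *)
Section weyl_level.
Context {R : realType}.
Local Notation e := (@expi2pi R).

Definition weyl_sum (n : nat) (Y s : R) : R[i] :=
  \sum_(0 <= k < n) e (k%:R * Y + k%:R ^+ 2 * s).

(** Above the generic size, only the multiples of [q] matter. The trivial bound
    for them gives [q * y <= 4 * n^2]. The bound by the geometric mean of [n] and
    the inverse distance gives [`|2 * s - a / q| <= 128 * n^-2 * z^2] with
    [z = n^2 / (q * y)]. As [z] is bounded below, the exponent 2 may be raised to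
    [rho]; this makes the lengths of these arcs summable over [a] and [q],
    and [n^(2 - 2 / rho)] is the matching choice of the generic size. *)
Lemma weyl_level (rho : R) : 2 < rho ->
  exists2 K : R, 0 < K &
    forall (n : nat) (y s Y : R), (0 < n)%N -> 0 < y ->
    y < normc (weyl_sum n Y s) ^+ 2 ->
    y <= K * n%:R `^ (2 - 2 / rho) \/
    exists q : nat, exists a : int,
      [/\ (0 < q <= 2 * n)%N, `|2 * s - a%:~R / q%:R| <= 1 &
          `|2 * s - a%:~R / q%:R| <=
          K * (n%:R ^- 2 * (n%:R ^+ 2 / (q%:R * y)) `^ rho)].
Proof.
move=> rho2; pose b := 1 - 2 / rho.
have r0 : 0 < rho by lra.
have b0 : 0 < b by rewrite subr_gt0 ltr_pdivrMr// mul1r.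
pose C := 12 * ((1 + b^-1) * 2 `^ b).
have C0 : 0 < C by rewrite !mulr_gt0 ?powR_gt0// addr_gt0// invr_gt0.
have K1 : 0 < 8 * 4 `^ rho :> R by rewrite mulr_gt0// powR_gt0.
exists (2 * (1 + 2 * C) + 8 * 4 `^ rho) => [|n y s Y n0 y0 yS].
  by rewrite addr_gt0// mulr_gt0// addr_gt0// mulr_gt0.
have nR : 0 < (n%:R : R) by rewrite ltr0n.
pose N := n%:R `^ (2 - 2 / rho) : R.
have NE : N = n%:R * n%:R `^ b.
  rewrite -[X in X * _](powRr1 (ltW nR)) -powRD; last by apply/implyP => _; rewrite gt_eqF.
  by congr (_ `^ _); rewrite /b; ring.
have nN : n%:R <= N.
  rewrite NE ler_peMr// -[leLHS](powRr0 n%:R) ler_powR ?(ltW b0)//.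
  by rewrite ler1n.
have [yN|Ny] := leP y (2 * (1 + 2 * C) * N).
  left; apply: le_trans yN _; rewrite ler_wpM2r ?powR_ge0// lerDl; exact: ltW.
right; have [|q [a [q2n aq xa]]] := @dirichlet R (2 * s) (2 * n).
  by rewrite muln_gt0.
have /andP[q0 q2] := q2n.
have qR : 0 < (q%:R : R) by rewrite ltr0n.
set g := q%:R * (2 * s) - a%:~R in xa.
have gE : `|2 * s - a%:~R / q%:R| = `|g| / q%:R.
  rewrite -[q%:R in RHS]gtr0_norm// -normf_div; congr `|_|.
  by rewrite /g; field; rewrite gt_eqF.
have yF (F : nat -> R) : (forall j, 0 <= F j) ->
    (forall j, (0 < j)%N -> (q * j < n)%N ->
      normc (\sum_(0 <= l < n - q * j) e (((q * j)%:R * (2 * s)) * l%:R)) <= F j) ->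
    y < 4 * \sum_(1 <= j < (n %/ q).+1) F j.
  move=> F0 FT.
  have := sum_diff_le n0 q0 q2 aq xa b0 F0 FT.
  have := weyl_differencing Y s n; rewrite -/(weyl_sum n Y s).
  rewrite natrM powRM// => H1 H2.
  have -> : \sum_(1 <= j < (n %/ q).+1) F j =
    \sum_(1 <= j < (n %/ q).+1) F j + C * N - C * N by rewrite addrK.
  have CE : 12 * n%:R * ((1 + b^-1) * (2 `^ b * n%:R `^ b)) = C * N.
    by rewrite NE /C; ring.
  rewrite CE in H2; nra.
have mq : (n %/ q)%:R <= n%:R / q%:R :> R.
  by rewrite ler_pdivlMr// -natrM ler_nat leq_trunc_div.
have qy : q%:R * y <= 4 * n%:R ^+ 2.
  have := yF (fun=> n%:R) (fun=> ler0n _ _)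
    (fun j _ _ => normc_diff_sum_le_size _ _ _).
  rewrite sumr_const_nat subSS subn0 -[n%:R *+ _]mulr_natr => yn.
  have : n%:R * (n %/ q)%:R <= n%:R * (n%:R / q%:R) :> R by rewrite ler_pM2l.
  move=> H; have H' : y <= 4 * (n%:R * (n%:R / q%:R)) by lra.
  have := ler_wpM2l (ltW qR) H'.
  have -> : q%:R * (4 * (n%:R * (n%:R / q%:R))) = 4 * n%:R ^+ 2 :> R.
    by field; rewrite gt_eqF.
  done.
have n2R : 1 <= (2 * n)%:R :> R by rewrite ler1n muln_gt0.
have q1 : q%:R^-1 <= 1 :> R by rewrite invf_le1// ler1n.
exists q, a; split => //; rewrite gE.
  rewrite ler_pdivrMr// mul1r (le_trans xa)//.
  by rewrite (@le_trans _ _ 1)// ?ler1n// invf_le1// (lt_le_trans _ n2R).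
have [g0|gn0] := eqVneq g 0.
  rewrite g0 normr0 mul0r mulr_ge0//; first by lra.
  by rewrite mulr_ge0 ?powR_ge0// invr_ge0 exprn_ge0// ltW.
have gp : 0 < `|g| by rewrite normr_gt0.
pose A := Num.sqrt (2 * n%:R / `|g|).
have A2 : A ^+ 2 = 2 * n%:R / `|g|.
  by rewrite sqr_sqrtr// divr_ge0// mulr_ge0// ltW.
have A0 : 0 <= A by rewrite sqrtr_ge0.
have yA : y < 4 * (A * (2 * Num.sqrt (n %/ q)%:R)).
  apply: lt_le_trans (yF (fun j => A * (Num.sqrt j%:R)^-1) _ _) _.
  - by move=> j; rewrite mulr_ge0// invr_ge0 sqrtr_ge0.
  - move=> j j0 jn; set T := normc _.
    have jR : 0 < (j%:R : R) by rewrite ltr0n.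
    have T0 : 0 <= T by rewrite normc_ge0.
    have T1 : T <= n%:R by apply: normc_diff_sum_le_size.
    have T2 : T <= 2 / (j%:R * `|g|) by apply: diff_sum_multiple.
    rewrite -(ler_pXn2r (n:=2)) ?nnegrE ?mulr_ge0 ?invr_ge0 ?sqrtr_ge0//.
    rewrite exprMn exprVn A2 sqr_sqrtr ?ler0n// expr2.
    apply: le_trans (ler_pM _ _ T1 T2) _ => //.
    rewrite le_eqVlt; apply/orP; left; apply/eqP.
    by field; rewrite !gt_eqF.
  - rewrite ler_pM2l// big_add1/= -mulr_sumr ler_wpM2l//.
    exact: sum_inv_sqrt_le.
have y2 : y ^+ 2 <= 128 * (n%:R ^+ 2 / (`|g| * q%:R)).
  have : y ^+ 2 <= (4 * (A * (2 * Num.sqrt (n %/ q)%:R))) ^+ 2.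
    by rewrite ler_pXn2r ?nnegrE ?(ltW y0)// ?(le_trans (ltW y0) (ltW yA))// ltW.
  move/le_trans; apply.
  rewrite !exprMn A2 sqr_sqrtr ?ler0n//.
  have -> : 128 * (n%:R ^+ 2 / (`|g| * q%:R)) =
      4 ^+ 2 * (2 * n%:R / `|g| * (2 ^+ 2 * (n%:R / q%:R))) :> R.
    by field; rewrite !gt_eqF.
  apply: ler_wpM2l; first exact: exprn_ge0.
  apply: ler_wpM2l; first by rewrite -A2 sqr_ge0.
  by apply: ler_wpM2l => //; exact: exprn_ge0.
set z := n%:R ^+ 2 / (q%:R * y).
have qy0 : 0 < q%:R * y by rewrite mulr_gt0.
have z1 : 1 <= 4 * z by rewrite /z mulrA ler_pdivlMr// mul1r.
have z2 : 16 * z ^+ 2 <= 4 `^ rho * z `^ rho.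
  have -> : 16 * z ^+ 2 = (4 * z) `^ 2%:R.
    by rewrite powR_mulrn; [ring|lra].
  by rewrite -powRM//; [rewrite ler_powR// ltW|lra].
have gz : `|g| / q%:R <= 8 * (n%:R ^- 2 * (16 * z ^+ 2)).
  have -> : 8 * (n%:R ^- 2 * (16 * z ^+ 2)) =
      128 * (n%:R ^+ 2 / (`|g| * q%:R)) / y ^+ 2 * (`|g| / q%:R).
    by rewrite /z; field; rewrite !gt_eqF.
  apply: ler_peMl; first by rewrite divr_ge0// ltW.
  by rewrite ler_pdivlMr ?exprn_gt0// mul1r.
apply: le_trans gz _.
have n2 : 0 <= n%:R ^- 2 :> R by rewrite invr_ge0 exprn_ge0// ltW.
have := ler_wpM2l n2 z2.
have : 0 <= n%:R ^- 2 * z `^ rho by rewrite mulr_ge0// powR_ge0.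
have := C0; nra.
Qed.

End weyl_level.

Section time_cover.
Context {R : realType}.

(** There are [O(q)] arcs of denominator [q] that meet the range of [2 * th * t],
    with a total length proportional to [q^(1 - rho)], which is summable as
    [rho > 2]. Below the generic size [n^(2 - 2 / rho)] the whole time interval is
    affordable. Covering by intervals, instead of measuring the set, makes
    the result easy to transport to differences of times; a pair in [s] is the
    centre and the radius of an interval. *)
Lemma weyl_cover (rho C L : R) : 2 < rho -> 1 <= C -> 0 <= L ->
  exists2 K : R, 0 < K &
    forall (n : nat) (th y : R), (0 < n)%N -> C^-1 <= th <= C -> 0 < y ->
    exists s : seq (R * R),
      [/\ forall i, i \in s -> 0 <= i.2,
          \sum_(i <- s) i.2 <= K * (y `^ (- rho) * n%:R `^ (2 * rho - 2)) &
          forall t Y, `|t| <= L ->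
            (forall i, i \in s -> i.2 < `|t - i.1|) ->
            normc (weyl_sum n Y (th * t)) ^+ 2 <= y].
Proof.
move=> rho2 C1 L0; have [K0 K00 level] := @weyl_level R rho rho2.
have C0 : 0 < C by lra.
have rho0 : 0 < rho by lra.
have [B BCL] : exists B : nat, 2 * C * L + 1 <= B%:R.
  by exists (Num.truncn (2 * C * L + 1)).+1; apply/ltW/truncnS_gt.
pose K2 := (2 * B%:R + 1) * (C * K0) * (1 + (rho - 2)^-1) : R.
have K20 : 0 <= K2.
  rewrite /K2 mulr_ge0//; last by rewrite addr_ge0// invr_ge0; lra.
  by rewrite mulr_ge0// ?addr_ge0 ?mulr_ge0//; lra.
exists (L * K0 `^ rho + K2 + 1) => [|n th y n0 /andP[th1 th2] y0].
  by rewrite ltr_wpDl// addr_ge0// mulr_ge0// powR_ge0.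
have th0 : 0 < th by apply: lt_le_trans th1; rewrite invr_gt0.
have nR : 0 < (n%:R : R) by rewrite ltr0n.
set cost := y `^ (- rho) * n%:R `^ (2 * rho - 2).
have cost0 : 0 <= cost by rewrite mulr_ge0 ?powR_ge0.
have KK (a : R) : a <= L * K0 `^ rho + K2 -> a * cost <= (L * K0 `^ rho + K2 + 1) * cost.
  by move=> aK; rewrite ler_wpM2r//; lra.
have LK : 0 <= L * K0 `^ rho by rewrite mulr_ge0// powR_ge0.
have [yK|Ky] := leP y (K0 * n%:R `^ (2 - 2 / rho)).
  exists [:: (0, L)]; split.
  - by move=> i; rewrite inE => /eqP ->.
  - rewrite big_seq1/=; apply: le_trans (KK (L * K0 `^ rho) _); last by rewrite lerDl.
    rewrite -mulrA ler_peMr//.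
    have -> : K0 `^ rho * cost = K0 `^ rho * n%:R `^ (2 * rho - 2) / y `^ rho.
      by rewrite /cost powRN; ring.
    rewrite ler_pdivlMr ?powR_gt0// mul1r.
    have -> : 2 * rho - 2 = (2 - 2 / rho) * rho by field; rewrite gt_eqF.
    rewrite powRrM -powRM ?powR_ge0 ?(ltW K00)//.
    apply: ge0_ler_powR => //; rewrite ?nnegrE ?(ltW y0) ?(ltW rho0)//.
    by rewrite mulr_ge0 ?powR_ge0// ltW.
  - by move=> t Y tL /(_ (0, L)); rewrite inE eqxx subr0 ltNge tL => /(_ isT).
pose r (q : nat) : R := K0 * (n%:R ^- 2 * (n%:R ^+ 2 / (q%:R * y)) `^ rho).
have rE q : (0 < q)%N -> r q = K0 * cost * q%:R `^ (- rho).
  move=> q0; have qR : 0 < (q%:R : R) by rewrite ltr0n.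
  have invE (x : R) : 0 < x -> x^-1 `^ rho = x `^ (- rho).
    by move=> x0; rewrite -powR_inv1 ?(ltW x0)// -powRrM mulN1r.
  have zE : (n%:R ^+ 2 / (q%:R * y)) `^ rho =
      (n%:R ^+ 2) `^ rho * (q%:R `^ (- rho) * y `^ (- rho)).
    rewrite invfM powRM ?exprn_ge0 ?mulr_ge0 ?invr_ge0 ?(ltW qR) ?(ltW y0) ?(ltW nR)//.
    by rewrite [X in _ * X]powRM ?invr_ge0 ?(ltW qR) ?(ltW y0)// !invE.
  rewrite /r /cost zE.
  have -> : n%:R `^ (2 * rho - 2) = n%:R ^- 2 * (n%:R ^+ 2) `^ rho :> R.
    rewrite -[_ ^+ 2]powR_mulrn ?(ltW nR)// -powRrM -powRN -powRD; last first.
      by apply/implyP => _; rewrite gt_eqF.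
    by congr powR; ring.
  by ring.
pose f (q k : nat) : R * R :=
  ((k%:Z - (q * B)%:Z)%:~R / q%:R / (2 * th), r q / (2 * th)).
have r0 q : 0 <= r q.
  by rewrite mulr_ge0 ?(ltW K00)// mulr_ge0 ?powR_ge0// invr_ge0 exprn_ge0.
exists [seq f q k | q <- iota 1 (2 * n), k <- iota 0 (2 * q * B).+1]; split.
- move=> i /allpairsPdep[q [k [_ _ ->]]]/=.
  by rewrite divr_ge0// mulr_ge0// ltW.
- rewrite big_allpairs_dep.
  apply: le_trans (KK K2 _); last by rewrite lerDr.
  apply: (@le_trans _ _ (\sum_(q <- iota 1 (2 * n))
      (2 * B%:R + 1) * (C * K0) * cost * q%:R `^ (1 - rho))).
    rewrite big_seq [leRHS]big_seq; apply: ler_sum => q; rewrite mem_iota => /andP[q0 _].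
    have qR : 1 <= (q%:R : R) by rewrite ler1n.
    have qR0 : 0 < (q%:R : R) by rewrite ltr0n.
    rewrite /f big_const_seq count_predT size_iota iter_addr_0 rE// -[_ *+ _]mulr_natr.
    have -> : q%:R `^ (1 - rho) = q%:R * q%:R `^ (- rho) :> R.
      rewrite powRD; last by apply/implyP => _; rewrite gt_eqF.
      by rewrite powRr1// ltW.
    have qB : (2 * q * B).+1%:R <= (2 * B%:R + 1) * q%:R :> R.
      by rewrite -natr1 !natrM; lra.
    have thC : (2 * th)^-1 <= C.
      rewrite invf_ple ?posrE ?mulr_gt0//; lra.
    set u := q%:R `^ (- rho); have u0 : 0 <= u by rewrite powR_ge0.
    have -> : (2 * B%:R + 1) * (C * K0) * cost * (q%:R * u) =
       K0 * cost * u * C * ((2 * B%:R + 1) * q%:R) by ring.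
    have v0 : 0 <= K0 * cost * u by rewrite mulr_ge0// mulr_ge0// ltW.
    apply: ler_pM => //; first by rewrite divr_ge0// mulr_ge0// ltW.
    exact: ler_wpM2l.
  rewrite -mulr_sumr /K2 -[leRHS]mulrAC; apply: ler_wpM2l.
    apply: mulr_ge0 => //; apply: mulr_ge0; first by rewrite addr_ge0// mulr_ge0.
    by rewrite mulr_ge0// ltW.
  have -> : iota 1 (2 * n) = index_iota 1 (2 * n).+1 by rewrite /index_iota subn1.
  have -> : 1 - rho = - (1 + (rho - 2)) by ring.
  by rewrite big_add1/=; apply: sum_powRN_le; lra.
- move=> t Y tL ts; rewrite leNgt; apply/negP => yS.
  have [//|[q [a [/andP[q0 q2] a1 ar]]]] := level n y (th * t) Y n0 y0 yS.
    by rewrite leNgt Ky.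
  have qR : 0 < (q%:R : R) by rewrite ltr0n.
  have aqB : (`|a| <= q * B)%N.
    rewrite -(ler_nat R) natr_absz intr_norm natrM -ler_pdivrMl// mulrC.
    rewrite -[X in _ / X]gtr0_norm// -normf_div (le_trans _ BCL)//.
    have : `|2 * (th * t)| <= 2 * C * L.
      rewrite !normrM ger0_norm// -mulrA ler_pM2l// gtr0_norm//.
      by apply: ler_pM => //; exact: ltW.
    have := ler_distD (2 * (th * t)) (a%:~R / q%:R : R) 0.
    rewrite !subr0 [X in X + _]distrC; lra.
  have : f q `|(a + (q * B)%:Z)%R|%N \in
      [seq f q k | q <- iota 1 (2 * n), k <- iota 0 (2 * q * B).+1].
    apply/allpairsPdep; exists q, `|(a + (q * B)%:Z)%R|%N.
    split; last by [].
      by rewrite mem_iota q0 add1n ltnS.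
    by rewrite mem_iota /= add0n; move: aqB; clear; lia.
  move=> /ts; rewrite /f/=.
  have -> : `|(a + (q * B)%:Z)%R|%N%:Z - (q * B)%:Z = a by move: aqB; clear; lia.
  have -> : t - a%:~R / q%:R / (2 * th) = (2 * (th * t) - a%:~R / q%:R) / (2 * th).
    by field; rewrite !gt_eqF.
  rewrite normf_div [`|2 * th|]gtr0_norm ?mulr_gt0// ltr_pM2r ?invr_gt0 ?mulr_gt0//.
  by rewrite ltNge ar.
Qed.

End time_cover.

(** * Exponential sums over boxes *)
Section box.
Context {R : realType} (d N : nat).
Local Notation e := (@expi2pi R).

Definition box_freq (f : {ffun 'I_d -> 'I_(2 * N).+1}) : d.-tuple int :=
  [tuple (f j)%:Z - N%:Z | j < d].

Lemma box_freq_inj : injective box_freq.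
Proof.
move=> f g fg; apply/ffunP => j; apply/val_inj => /=.
have := congr1 (fun v => tnth v j) fg; rewrite !tnth_mktuple; lia.
Qed.

Lemma box_freqP (v : d.-tuple int) :
  (forall j, `|tnth v j| <= N%:Z) -> exists f, v = box_freq f.
Proof.
move=> vN; exists [ffun j => inord (absz (tnth v j + N%:Z))].
apply: eq_from_tnth => j; rewrite tnth_mktuple ffunE inordK; have := vN j; lia.
Qed.

(** The exponential sum over a box is a product of one-dimensional quadratic
    sums; the shift of the box to the origin changes each factor by a phase
    and a translation of its linear coefficient. *)
Lemma box_kernelE (alpha : 'I_d -> R) (Y : 'I_d -> R) (t : R) :
  normc (\sum_f e (\sum_j (tnth (box_freq f) j)%:~R * Y j +
    qform alpha (box_freq f) * t)) =
  \prod_j normc (weyl_sum (2 * N).+1 (Y j - 2 * N%:R * (theta alpha j * t))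
    (theta alpha j * t)).
Proof.
pose c j : R := - N%:R * Y j + N%:R ^+ 2 * (theta alpha j * t).
pose z j (k : 'I_(2 * N).+1) : R[i] := e (c j) *
   e (k%:R * (Y j - 2 * N%:R * (theta alpha j * t)) + k%:R ^+ 2 * (theta alpha j * t)).
have normc_prod (F : 'I_d -> R[i]) : normc (\prod_j F j) = \prod_j normc (F j).
  by elim/big_rec2: _ => [|j x y _ <-]; rewrite ?Normc.normc1 ?normcM.
rewrite [X in normc X](_ : _ = \sum_(f : {ffun 'I_d -> 'I_(2 * N).+1}) \prod_j z j (f j)).
  rewrite -(bigA_distr_bigA z) normc_prod; apply: eq_bigr => j _.
  by rewrite /z -mulr_sumr normcM normc_expi2pi mul1r /weyl_sum big_mkord.
apply: eq_bigr => f _; rewrite /qform mulr_suml -big_split/= expi2pi_sum.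
apply: eq_bigr => j _; rewrite /z -expi2piD tnth_mktuple; congr e.
by rewrite rmorphB/= /c; ring.
Qed.

End box.

Section kernel_cover.
Context {R : realType} (d : nat).
Local Notation e := (@expi2pi R).

(** A product of [d] factors exceeds [H] only if one of the factors exceeds
    [H^(1 / d)]. *)
Lemma kernel_cover (rho C L : R) : (0 < d)%N -> 2 < rho -> 1 <= C -> 0 <= L ->
  exists2 K : R, 0 < K &
    forall (N : nat) (alpha : 'I_d -> R) (H : R),
    (forall j, C^-1 <= theta alpha j <= C) -> 0 < H ->
    exists s : seq (R * R),
      [/\ forall i, i \in s -> 0 <= i.2,
          \sum_(i <- s) i.2 <=
            K * (H `^ (- (2 * rho / d%:R)) * (2 * N).+1%:R `^ (2 * rho - 2)) &
          forall t (Y : 'I_d -> R), `|t| <= L ->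
            (forall i, i \in s -> i.2 < `|t - i.1|) ->
            normc (\sum_(f : {ffun 'I_d -> 'I_(2 * N).+1})
              e (\sum_j (tnth (box_freq f) j)%:~R * Y j +
                 qform alpha (box_freq f) * t)) <= H].
Proof.
move=> d0 rho2 C1 L0; have [K K0 cover] := weyl_cover rho2 C1 L0.
have dR : 0 < (d%:R : R) by rewrite ltr0n.
exists (d%:R * K) => [|N alpha H th H0]; first by rewrite mulr_gt0.
pose y := H `^ (2 / d%:R); have y0 : 0 < y by rewrite powR_gt0.
have /choice[s sP] := fun j => cover (2 * N).+1 (theta alpha j) y isT (th j) y0.
exists [seq i | j <- enum 'I_d, i <- s j]; split.
- by move=> i /allpairsPdep[j [k [_ ks ->]]]; have [+ _ _] := sP j; apply.
- rewrite big_allpairs_dep/=.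
  apply: (@le_trans _ _ (\sum_(j <- enum 'I_d)
      K * (y `^ (- rho) * (2 * N).+1%:R `^ (2 * rho - 2)))).
    by apply: ler_sum => j _; have [_ + _] := sP j.
  rewrite big_const_seq count_predT size_enum_ord iter_addr_0 -[_ *+ d]mulr_natl mulrA.
  rewrite /y -powRrM; have -> // : 2 / d%:R * - rho = - (2 * rho / d%:R) by ring.
- move=> t Y tL ts; rewrite box_kernelE.
  have HE : H = \prod_(j < d) Num.sqrt y.
    rewrite prodr_const card_ord -powR12_sqrt ?powR_ge0// -powR_mulrn ?powR_ge0//.
    rewrite /y -!powRrM; have -> : 2 / d%:R * (2^-1 * d%:R) = 1 :> R.
      by field; rewrite gt_eqF.
    by rewrite powRr1// ltW.
  rewrite [leRHS]HE; apply: ler_prod => j _; rewrite normc_ge0/=.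
  rewrite -(ler_pXn2r (n:=2)) ?nnegrE ?normc_ge0 ?sqrtr_ge0// sqr_sqrtr ?(ltW y0)//.
  have [_ _ ->//] := sP j => i si; apply: ts.
  by apply/allpairsPdep; exists j, i; rewrite mem_enum.
Qed.

End kernel_cover.

(** * Integration of complex-valued functions *)
Section cmeasurable_functions.
Context {R : realType} {dT : measure_display} {T : measurableType dT}.
Implicit Types (g h : T -> R[i]).

Definition cmeas g :=
  measurable_fun [set: T] (fun x => complex.Re (g x)) /\
  measurable_fun [set: T] (fun x => complex.Im (g x)).

Definition cbounded g := cmeas g /\ exists M, forall x, normc (g x) <= M.

Lemma cmeas_normc g : cmeas g -> measurable_fun [set: T] (fun x => normc (g x)).
Proof.
move=> [mr mi]; rewrite (_ : (fun x => _) =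
  (fun x => Num.sqrt (complex.Re (g x) ^+ 2 + complex.Im (g x) ^+ 2))).
  have msqrt : measurable_fun [set: R] (@Num.sqrt R).
    by apply: continuous_measurable_fun; exact: sqrt_continuous.
  apply: (measurableT_comp msqrt).
  by apply: measurable_funD; exact: measurable_funX.
by apply/funext => x; case: (g x).
Qed.

Lemma cmeasD g h : cmeas g -> cmeas h -> cmeas (fun x => g x + h x).
Proof.
move=> [g1 g2] [h1 h2]; split.
- under eq_fun do rewrite cReD; exact: measurable_funD.
- under eq_fun do rewrite cImD; exact: measurable_funD.
Qed.

Lemma cmeasM g h : cmeas g -> cmeas h -> cmeas (fun x => g x * h x).
Proof.
move=> [g1 g2] [h1 h2]; split.
- under eq_fun do rewrite cReM.
  by apply: measurable_funB; exact: measurable_funM.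
- under eq_fun do rewrite cImM.
  by apply: measurable_funD; exact: measurable_funM.
Qed.

Lemma cmeasJ g : cmeas g -> cmeas (fun x => (g x)^*).
Proof.
move=> [g1 g2]; split.
- rewrite (_ : (fun x => _) = (fun x => complex.Re (g x)))//.
  by apply/funext => x; case: (g x).
- rewrite (_ : (fun x => _) = (fun x => - complex.Im (g x))).
    exact: measurableT_comp.
  by apply/funext => x; case: (g x).
Qed.

Lemma cmeas_cst (c : R[i]) : cmeas (fun=> c).
Proof. by split; exact: measurable_cst. Qed.

Lemma cmeas_real (k : T -> R) : measurable_fun [set: T] k ->
  cmeas (fun x => (k x)%:C).
Proof. by move=> mk; split => //; exact: measurable_cst. Qed.

Lemma cmeas_sum (I : Type) (r : seq I) (F : I -> T -> R[i]) :
  (forall i, cmeas (F i)) -> cmeas (fun x => \sum_(i <- r) F i x).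
Proof.
move=> mF; elim: r => [|i r IH].
  under eq_fun do rewrite big_nil; exact: cmeas_cst.
by under eq_fun do rewrite big_cons; exact: cmeasD.
Qed.

Lemma cmeas_expi2pi (k : T -> R) : measurable_fun [set: T] k ->
  cmeas (fun x => expi2pi (k x)).
Proof.
move=> mk; have m2 : measurable_fun [set: T] (fun x => 2 * pi * k x).
  exact: measurable_funM.
split; apply: measurableT_comp m2 => //; apply: continuous_measurable_fun.
- exact: continuous_cos.
- exact: continuous_sin.
Qed.

Lemma cboundedM g h : cbounded g -> cbounded h -> cbounded (fun x => g x * h x).
Proof.
move=> [mg [M gM]] [mh [M' hM]]; split; first exact: cmeasM.
by exists (M * M') => x; rewrite normcM ler_pM// normc_ge0.
Qed.

Lemma cboundedD g h : cbounded g -> cbounded h -> cbounded (fun x => g x + h x).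
Proof.
move=> [mg [M gM]] [mh [M' hM]]; split; first exact: cmeasD.
by exists (M + M') => x; rewrite (le_trans (ler_normcD _ _))// lerD.
Qed.

Lemma cboundedJ g : cbounded g -> cbounded (fun x => (g x)^*).
Proof.
move=> [mg [M gM]]; split; first exact: cmeasJ.
by exists M => x; rewrite normc_conjc.
Qed.

Lemma cbounded_cst (c : R[i]) : cbounded (fun=> c).
Proof. by split; [exact: cmeas_cst|exists (normc c)]. Qed.

Lemma cbounded_sum (I : Type) (r : seq I) (F : I -> T -> R[i]) :
  (forall i, cbounded (F i)) -> cbounded (fun x => \sum_(i <- r) F i x).
Proof.
move=> mF; elim: r => [|i r IH].
  under eq_fun do rewrite big_nil; exact: cbounded_cst.
by under eq_fun do rewrite big_cons; exact: cboundedD.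
Qed.

Lemma cbounded_expi2pi (k : T -> R) : measurable_fun [set: T] k ->
  cbounded (fun x => expi2pi (k x)).
Proof.
move=> mk; split; first exact: cmeas_expi2pi.
by exists 1 => x; rewrite normc_expi2pi.
Qed.

Lemma cbounded_indic (E : set T) : measurable E ->
  cbounded (fun x => (\1_E x : R)%:C).
Proof.
move=> mE; split; first by apply: cmeas_real; exact: measurable_indic.
by exists 1 => x; rewrite normc_real indicE; case: (_ \in _); rewrite ?normr1 ?normr0.
Qed.

Lemma measurable_normc_EFin g : cmeas g ->
  measurable_fun [set: T] (fun x => (normc (g x))%:E).
Proof. by move=> mg; apply/measurable_EFinP; exact: cmeas_normc. Qed.

Variable mu : {measure set T -> \bar R}.

Definition cintegrable g :=
  cmeas g /\ (\int[mu]_x (normc (g x))%:E < +oo)%E.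

Lemma integrable_scale (k : R) (f : T -> R) :
  mu.-integrable [set: T] (EFin \o f) ->
  mu.-integrable [set: T] (EFin \o (fun x => k * f x)).
Proof. by move=> fi; have := integrableZl measurableT k fi. Qed.

Lemma integrable_normc g : cintegrable g ->
  mu.-integrable [set: T] (EFin \o (fun x => normc (g x))).
Proof.
move=> [mg goo]; apply/integrableP; split; first exact: measurable_normc_EFin.
by under eq_integral do rewrite /= ger0_norm ?normc_ge0//.
Qed.

Lemma integrable_Re g : cintegrable g ->
  mu.-integrable [set: T] (EFin \o (fun x => complex.Re (g x))).
Proof.
move=> ig; apply: le_integrable (integrable_normc ig) => //.
  by apply/measurable_EFinP; case: ig => -[].
by move=> x _ /=; rewrite lee_fin [leRHS]ger0_norm ?normc_ge0// normr_Re_le.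
Qed.

Lemma integrable_Im g : cintegrable g ->
  mu.-integrable [set: T] (EFin \o (fun x => complex.Im (g x))).
Proof.
move=> ig; apply: le_integrable (integrable_normc ig) => //.
  by apply/measurable_EFinP; case: ig => -[].
by move=> x _ /=; rewrite lee_fin [leRHS]ger0_norm ?normc_ge0// normr_Im_le.
Qed.

Lemma le_cintegrable g (k : T -> R) : cmeas g ->
  mu.-integrable [set: T] (EFin \o k) ->
  (forall x, normc (g x) <= k x) -> cintegrable g.
Proof.
move=> mg ik gk; split => //.
have ig : mu.-integrable [set: T] (EFin \o (fun x => normc (g x))).
  apply: le_integrable ik => //; first exact: measurable_normc_EFin.
  move=> x _ /=; rewrite lee_fin ger0_norm ?normc_ge0//.
  exact: le_trans (gk x) (ler_norm _).
move/integrableP : ig => [_]; under eq_integral do rewrite /= ger0_norm ?normc_ge0//.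
by [].
Qed.

Lemma cintegrableD g h : cintegrable g -> cintegrable h ->
  cintegrable (fun x => g x + h x).
Proof.
move=> ig ih; apply: (@le_cintegrable _ (fun x => normc (g x) + normc (h x))).
- by apply: cmeasD; [case: ig|case: ih].
- exact: integrableD (integrable_normc ig) (integrable_normc ih).
- by move=> x; exact: ler_normcD.
Qed.

Lemma cintegrableZ (c : R[i]) g : cintegrable g -> cintegrable (fun x => c * g x).
Proof.
move=> ig; apply: (@le_cintegrable _ (fun x => normc c * normc (g x))).
- by apply: cmeasM; [exact: cmeas_cst|case: ig].
- exact: integrable_scale (integrable_normc ig).
- by move=> x; rewrite normcM.
Qed.

Lemma cintegrable_sum (I : Type) (r : seq I) (F : I -> T -> R[i]) :
  (forall i, cintegrable (F i)) -> cintegrable (fun x => \sum_(i <- r) F i x).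
Proof.
move=> mF; elim: r => [|i r IH].
  under eq_fun do rewrite big_nil; split; first exact: cmeas_cst.
  under eq_integral do rewrite Normc.normc0.
  by rewrite integral0 ltry.
by under eq_fun do rewrite big_cons; exact: cintegrableD.
Qed.

Lemma cintegral_Re g : complex.Re (cintegral mu g) = \int[mu]_x complex.Re (g x).
Proof. by []. Qed.

Lemma cintegralD g h : cintegrable g -> cintegrable h ->
  cintegral mu (fun x => g x + h x) = cintegral mu g + cintegral mu h.
Proof.
move=> ig ih; apply/eqP; rewrite eq_complex cReD cImD /=; apply/andP; split; apply/eqP.
- under eq_Rintegral do rewrite cReD.
  by rewrite RintegralD//; exact: integrable_Re.
- under eq_Rintegral do rewrite cImD.
  by rewrite RintegralD//; exact: integrable_Im.
Qed.

Lemma cintegralZ (c : R[i]) g : cintegrable g ->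
  cintegral mu (fun x => c * g x) = c * cintegral mu g.
Proof.
move=> ig; apply/eqP; rewrite eq_complex cReM cImM /=.
have iR := integrable_Re ig; have iI := integrable_Im ig.
apply/andP; split; apply/eqP.
- under eq_Rintegral do rewrite cReM.
  by rewrite RintegralB ?RintegralZl//; exact: integrable_scale.
- under eq_Rintegral do rewrite cImM.
  by rewrite RintegralD ?RintegralZl//; exact: integrable_scale.
Qed.

Lemma cintegralZr (c : R[i]) g : cintegrable g ->
  cintegral mu (fun x => g x * c) = cintegral mu g * c.
Proof.
by move=> ig; rewrite mulrC -cintegralZ//; congr cintegral; apply/funext => x; rewrite mulrC.
Qed.

Lemma cintegralJ g : cintegrable g ->
  cintegral mu (fun x => (g x)^*) = (cintegral mu g)^*.
Proof.
move=> ig; have iI := integrable_Im ig.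
apply/eqP; rewrite eq_complex /=; apply/andP; split; apply/eqP.
- by apply: eq_Rintegral => x _; case: (g x).
- rewrite -mulN1r -RintegralZl//; apply: eq_Rintegral => x _.
  by rewrite mulN1r; case: (g x).
Qed.

Lemma cintegral0 : cintegral mu (fun=> 0) = 0.
Proof.
by apply/eqP; rewrite eq_complex /= /Rintegral !integral0 eqxx.
Qed.

Lemma cintegral_sum (I : Type) (r : seq I) (F : I -> T -> R[i]) :
  (forall i, cintegrable (F i)) ->
  cintegral mu (fun x => \sum_(i <- r) F i x) = \sum_(i <- r) cintegral mu (F i).
Proof.
move=> iF; elim: r => [|i r IH].
  rewrite big_nil (_ : (fun x => _) = (fun=> 0)) ?cintegral0//.
  by apply/funext => x; rewrite big_nil.
rewrite big_cons -IH -cintegralD//; last exact: cintegrable_sum.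
by congr cintegral; apply/funext => x; rewrite big_cons.
Qed.

(** Rotating the integral onto the positive real axis reduces the triangle
    inequality to the monotonicity of the real integral. *)
Lemma normc_cintegral_le g : cintegrable g ->
  normc (cintegral mu g) <= \int[mu]_x normc (g x).
Proof.
move=> ig; set z := cintegral mu g.
have I0 : 0 <= \int[mu]_x normc (g x).
  by apply: Rintegral_ge0 => x _; rewrite normc_ge0.
have [z0|z0] := eqVneq (normc z) 0; first by rewrite z0.
have zp : 0 < normc z by rewrite lt_def z0 normc_ge0.
rewrite -(ler_pM2l zp) -expr2.
have -> : normc z ^+ 2 = complex.Re (cintegral mu (fun x => z^* * g x)).
  by rewrite cintegralZ// mulrC mulcJ.
rewrite cintegral_Re -RintegralZl//; last exact: integrable_normc.
apply: le_Rintegral => //.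
- by apply: integrable_Re; exact: cintegrableZ.
- by apply: integrable_scale; exact: integrable_normc.
- by move=> x _; rewrite (le_trans (ler_norm _))// (le_trans (normr_Re_le _))// normcM normc_conjc.
Qed.

Lemma normc_cintegral_lee g : cintegrable g ->
  ((normc (cintegral mu g))%:E <= \int[mu]_x (normc (g x))%:E)%E.
Proof.
move=> ig; have := normc_cintegral_le ig.
rewrite -lee_fin /Rintegral fineK//.
by apply: integrable_fin_num => //; exact: integrable_normc.
Qed.

End cmeasurable_functions.

Section finite_measure.
Context {R : realType} {dT : measure_display} {T : measurableType dT}.
Variable mu : {finite_measure set T -> \bar R}.

Lemma cbounded_integrable (g : T -> R[i]) : cbounded g -> cintegrable mu g.
Proof.
move=> [mg [M gM]]; apply: (@le_cintegrable _ _ _ _ _ (fun=> M)) => //.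
exact: finite_measure_integrable_cst.
Qed.

Lemma integrable_sqr_normc (g : T -> R[i]) : cmeas g ->
  (\int[mu]_x (normc (g x) ^+ 2)%:E < +oo)%E ->
  mu.-integrable [set: T] (EFin \o (fun x => normc (g x) ^+ 2)).
Proof.
move=> mg goo; apply/integrableP; split.
  by apply/measurable_EFinP; apply: measurable_funX; exact: cmeas_normc.
by under eq_integral do rewrite /= ger0_norm ?sqr_ge0//.
Qed.

Lemma cintegrableM (g h : T -> R[i]) : cmeas g ->
  (\int[mu]_x (normc (g x) ^+ 2)%:E < +oo)%E -> cbounded h ->
  cintegrable mu (fun x => g x * h x).
Proof.
move=> mg goo bh; have [mh [M hM]] := bh.
have i1 : mu.-integrable [set: T] (EFin \o (fun=> 1 : R)).
  exact: finite_measure_integrable_cst.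
have i2 := integrable_sqr_normc mg goo.
apply: (@le_cintegrable _ _ _ _ _ (fun x => M * (1 + normc (g x) ^+ 2))).
- exact: cmeasM.
- apply: integrable_scale; exact: integrableD i1 i2.
- move=> x; rewrite normcM mulrC; apply: ler_pM; rewrite ?normc_ge0//.
  by have := sqr_ge0 (normc (g x) - 1); nra.
Qed.

(** With [P] the orthogonal projection of [g], integrate
    [2 * Re (g * conj P) <= |g|^2 + |P|^2]: the integrals of [g * conj P] and of
    [|P|^2] are both the sum of the squares of the coefficients. *)
Lemma bessel (I : finType) (phi : I -> T -> R[i]) (g : T -> R[i]) :
  (forall i, cbounded (phi i)) ->
  (forall i j, cintegral mu (fun x => phi i x * (phi j x)^*) = (i == j)%:R) ->
  cmeas g -> (\int[mu]_x (normc (g x) ^+ 2)%:E < +oo)%E ->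
  ((\sum_i normc (cintegral mu (fun x => g x * (phi i x)^*)) ^+ 2)%:E <=
   \int[mu]_x (normc (g x) ^+ 2)%:E)%E.
Proof.
move=> bphi orth mg goo; have ig := integrable_sqr_normc mg goo.
pose c i := cintegral mu (fun x => g x * (phi i x)^*).
pose P x := \sum_i c i * phi i x.
set S := \sum_i _.
have bP : cbounded P.
  by apply: cbounded_sum => i; apply: cboundedM => //; exact: cbounded_cst.
have bJ i : cbounded (fun x => (phi i x)^*) by exact: cboundedJ.
have igP : cintegrable mu (fun x => g x * (P x)^*).
  by apply: cintegrableM => //; exact: cboundedJ.
have gP : cintegral mu (fun x => g x * (P x)^*) = S%:C.
  rewrite (_ : (fun x => _) = fun x => \sum_i (c i)^* * (g x * (phi i x)^*)).
    rewrite cintegral_sum => [|i]; last by apply: cintegrableZ; exact: cintegrableM.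
    rewrite /S rmorph_sum/=; apply: eq_bigr => i _.
    have := cintegralZ (c i)^* (cintegrableM mg goo (bJ i)).
    by rewrite -/(c i) mulrC mulcJ.
  apply/funext => x; rewrite conjc_sum mulr_sumr; apply: eq_bigr => i _.
  by rewrite rmorphM/=; ring.
have PP : cintegral mu (fun x => P x * (P x)^*) = S%:C.
  have bphiJ i j : cbounded (fun x => phi i x * (phi j x)^*) by exact: cboundedM.
  have phiP i : cintegral mu (fun x => phi i x * (P x)^*) = (c i)^*.
    rewrite (_ : (fun x => _) = fun x => \sum_j (c j)^* * (phi i x * (phi j x)^*)).
      rewrite cintegral_sum => [|j]; last by apply: cintegrableZ; exact: cbounded_integrable.
      rewrite (bigD1 i)//= big1 => [|j ji].
        rewrite (cintegralZ (c i)^* (cbounded_integrable (bphiJ i i))).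
        by rewrite orth eqxx mulr1 addr0.
      rewrite (cintegralZ (c j)^* (cbounded_integrable (bphiJ i j))).
      by rewrite orth eq_sym (negbTE ji) mulr0.
    apply/funext => x; rewrite conjc_sum mulr_sumr; apply: eq_bigr => j _.
    by rewrite rmorphM/=; ring.
  have bphiP i : cbounded (fun x => phi i x * (P x)^*).
    by apply: cboundedM => //; exact: cboundedJ.
  rewrite (_ : (fun x => _) = fun x => \sum_i c i * (phi i x * (P x)^*)).
    rewrite cintegral_sum => [|i]; last by apply: cintegrableZ; exact: cbounded_integrable.
    rewrite /S rmorph_sum/=; apply: eq_bigr => i _.
    have := cintegralZ (c i) (cbounded_integrable (bphiP i)).
    by rewrite phiP mulcJ.
  by apply/funext => x; rewrite mulr_suml; apply: eq_bigr => i _; rewrite mulrA.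
have iPP : cintegrable mu (fun x => P x * (P x)^*).
  by apply: cbounded_integrable; apply: cboundedM => //; exact: cboundedJ.
have iRP : mu.-integrable [set: T] (EFin \o (fun x => normc (P x) ^+ 2)).
  rewrite (_ : (fun x => _) = (fun x => complex.Re (P x * (P x)^*))).
    exact: integrable_Re.
  by apply/funext => x; rewrite mulcJ.
have SP : \int[mu]_x (normc (P x) ^+ 2) = S.
  have := congr1 (@complex.Re R) PP; rewrite cintegral_Re/= => <-.
  by apply: eq_Rintegral => x _; rewrite mulcJ.
have key : 2 * S <= \int[mu]_x (normc (g x) ^+ 2) + S.
  rewrite -{2}SP -RintegralD//.
  have <- : complex.Re (cintegral mu (fun x => g x * (P x)^*)) = S by rewrite gP.
  rewrite cintegral_Re -RintegralZl//; last exact: integrable_Re.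
  apply: le_Rintegral => //.
  - by apply: integrable_scale; exact: integrable_Re.
  - exact: integrableD ig iRP.
  - move=> x _; rewrite !sqr_normcE; case: (g x) => a b; case: (P x) => u v /=.
    by have := sqr_ge0 (a - u); have := sqr_ge0 (b - v); nra.
have : S <= \int[mu]_x (normc (g x) ^+ 2) by lra.
rewrite -lee_fin /Rintegral fineK//.
exact: integrable_fin_num ig.
Qed.

End finite_measure.

(** * The level set estimate *)
Section product_section.
Context {R : realType} {d1 d2 : measure_display}.
Context {T : measurableType d1} {X : measurableType d2}.
Variables (nu : {finite_measure set T -> \bar R}) (tau : {finite_measure set X -> \bar R}).

Lemma product_measure_lty : ((nu \x tau)%E [set: T * X] < +oo)%E.
Proof.
rewrite -setXTT product_measure1E//; apply: lte_mul_pinfty => //.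
- exact: fin_num_measure.
- by rewrite ltey_eq fin_num_measure.
Qed.

Lemma cbounded_section1 (h : T * X -> R[i]) t : cbounded h -> cbounded (fun x => h (t, x)).
Proof.
move=> [[m1 m2] [M hM]]; split; last by exists M => x.
by split; [exact: measurableT_comp m1 _|exact: measurableT_comp m2 _].
Qed.

Lemma cbounded_fst (h : T -> R[i]) : cbounded h -> cbounded (fun z : T * X => h z.1).
Proof.
move=> [[m1 m2] [M hM]]; split; last by exists M => x.
by split; [exact: measurableT_comp m1 _|exact: measurableT_comp m2 _].
Qed.

Lemma cbounded_snd (h : X -> R[i]) : cbounded h -> cbounded (fun z : T * X => h z.2).
Proof.
move=> [[m1 m2] [M hM]]; split; last by exists M => x.
by split; [exact: measurableT_comp m1 _|exact: measurableT_comp m2 _].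
Qed.

Lemma cbounded_integral1 (h : T * X -> R[i]) : cbounded h ->
  cbounded (fun t => cintegral tau (fun x => h (t, x))).
Proof.
move=> bh; have [mh [M hM]] := bh.
have ih : cintegrable (nu \x tau)%E h.
  apply: (@le_cintegrable _ _ _ _ _ (fun=> M)) => //.
  apply: measurable_bounded_integrable => //; first exact: product_measure_lty.
  exact: bounded_cst.
have mF (f : T * X -> R) : (nu \x tau)%E.-integrable [set: T * X] (EFin \o f) ->
    measurable_fun [set: T] (fun t => \int[tau]_x f (t, x)).
  move=> ifx; apply: (@measurableT_comp _ _ _ _ _ _ fine) => //.
  exact: measurable_fubini_F ifx.
split; first by split; [exact: mF (integrable_Re ih)|exact: mF (integrable_Im ih)].
exists (\int[tau]_x M) => t.
have it : cintegrable tau (fun x => h (t, x)).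
  by apply: cbounded_integrable; exact: cbounded_section1.
apply: le_trans (normc_cintegral_le it) _; apply: le_Rintegral => //.
- exact: integrable_normc.
- exact: finite_measure_integrable_cst.
Qed.

End product_section.

Lemma normc_cintegralM_le {R : realType} {dT} {T : measurableType dT}
    (mu : {finite_measure set T -> \bar R}) (g h : T -> R[i]) (K : R) :
  cbounded g -> cbounded h -> (forall x, normc (h x) <= K) ->
  normc (cintegral mu (fun x => g x * h x)) <= K * \int[mu]_x normc (g x).
Proof.
move=> bg bh hK; have igh := cbounded_integrable mu (cboundedM bg bh).
have ig := integrable_normc (cbounded_integrable mu bg).
apply: le_trans (normc_cintegral_le igh) _; rewrite -RintegralZl//.
apply: le_Rintegral => //; first exact: integrable_normc.
  exact: integrable_scale.
by move=> x _; rewrite normcM mulrC ler_wpM2r ?normc_ge0.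
Qed.

Lemma ge0_integralZl_real {R : realType} {dT} {T : measurableType dT}
    (mu : {measure set T -> \bar R}) (k : R) (f : T -> R) :
  0 <= k -> (forall x, 0 <= f x) -> measurable_fun [set: T] f ->
  (\int[mu]_x (k * f x)%:E = k%:E * \int[mu]_x (f x)%:E)%E.
Proof.
move=> k0 f0 mf; under eq_integral do rewrite EFinM.
by rewrite ge0_integralZl_EFin// => [x _|]; [rewrite lee_fin|apply/measurable_EFinP].
Qed.

Section level_set.
Context {R : realType} {d1 d2 : measure_display}.
Context {T : measurableType d1} {X : measurableType d2}.
Variables (nu : {finite_measure set T -> \bar R}) (tau : {finite_measure set X -> \bar R}).
Variables (I : finType) (phi : I -> X -> R[i]) (om : I -> T -> R[i]) (c : I -> R[i]).
(* The weight [kappa] is at least 1 at the pairs of times where the kernel is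
   not bounded by [H]; [m] bounds its marginals. Only [`|om i t| <= 1] is asked
   of the time factors, so that they may vanish outside of an interval. *)
Variables (kappa : T * T -> R) (m H A lam : R).
Hypotheses (bphi : forall i, cbounded (phi i))
  (orth : forall i j, cintegral tau (fun x => phi i x * (phi j x)^*) = (i == j)%:R).
Hypotheses (mom : forall i, cmeas (om i)) (om1 : forall i t, normc (om i t) <= 1).
Hypotheses (mkappa : measurable_fun [set: T * T] kappa) (kappa0 : forall z, 0 <= kappa z)
  (kappam1 : forall t, (\int[nu]_s (kappa (t, s))%:E <= m%:E)%E)
  (kappam2 : forall s, (\int[nu]_t (kappa (t, s))%:E <= m%:E)%E).
Hypothesis kernelH : forall t s x y, kappa (t, s) < 1 ->
  normc (\sum_i (om i t * phi i x) * (om i s * phi i y)^*) <= H.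
Hypotheses (H0 : 0 <= H) (m0 : 0 <= m) (cA : \sum_i normc (c i) ^+ 2 <= A ^+ 2) (lam0 : 0 < lam)
  (AH : 2 * A ^+ 2 * H <= lam ^+ 2).

Let u (z : T * X) : R[i] := \sum_i c i * (om i z.1 * phi i z.2).
Let E : set (T * X) := [set z | lam < normc (u z)].

Let bom i : cbounded (om i). Proof. by split=> //; exists 1. Qed.

Let bu : cbounded u.
Proof.
apply: cbounded_sum => i; apply: cboundedM; first exact: cbounded_cst.
by apply: cboundedM; [exact: cbounded_fst|exact: cbounded_snd].
Qed.

Let mE : measurable E.
Proof.
rewrite (_ : E = ((fun z => normc (u z)) @^-1` `]lam, +oo[)%classic).
  by rewrite -[X in measurable X]setTI; apply: cmeas_normc => //; case: bu.
by apply/seteqP; split => z /=; rewrite in_itv/= andbT.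
Qed.

Let w (z : T * X) : R[i] := (\1_E z : R)%:C * (u z)^*.

Let bw : cbounded w.
Proof. by apply: cboundedM; [exact: cbounded_indic|exact: cboundedJ]. Qed.

Let bwt t : cbounded (fun x => w (t, x)). Proof. exact: cbounded_section1. Qed.

Let w2E z : normc (w z) ^+ 2 = \1_E z * normc (u z) ^+ 2.
Proof.
rewrite /w normcM normc_real normc_conjc exprMn indicE; case: (_ \in _).
- by rewrite normr1 expr1n.
- by rewrite normr0 expr0n/= !mul0r.
Qed.

Let wuE z : w z * u z = ((normc (w z) ^+ 2)%:C : R[i]).
Proof.
rewrite w2E /w -mulrA [(u z)^* * _]mulrC mulcJ.
by apply/eqP; rewrite eq_complex/= !mulr0 !mul0r subr0 addr0 !eqxx.
Qed.

(* [V i t] is the factor [om i t] times the coefficient of [w (t, .)] on the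
   conjugate of [phi i]. *)
Let V i t : R[i] := cintegral tau (fun x => w (t, x) * phi i x) * om i t.

Let bV i : cbounded (V i).
Proof.
apply: cboundedM => //; apply: (@cbounded_integral1 _ _ _ _ _ nu tau
  (fun z => w z * phi i z.2)).
by apply: cboundedM => //; exact: cbounded_snd.
Qed.

Let b t : R := \int[tau]_x (normc (w (t, x)) ^+ 2).
Let a t : R := \int[tau]_x normc (w (t, x)).

Let bnd_real (k : T * X -> R) : cbounded (fun z => (k z)%:C) ->
  cbounded (fun t => (\int[tau]_x k (t, x))%:C).
Proof.
move=> bk; have := cbounded_integral1 nu tau bk.
rewrite (_ : (fun t => cintegral _ _) = (fun t => (\int[tau]_x k (t, x))%:C))//.
apply/funext => t; apply/eqP; rewrite eq_complex/= eqxx/=.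
by rewrite Rintegral_cst// mul0r.
Qed.

Let bw2 : cbounded (fun z => (normc (w z) ^+ 2)%:C : R[i]).
Proof.
rewrite (_ : (fun z => _) = fun z => w z * (w z)^*).
  by apply: cboundedM => //; exact: cboundedJ.
by apply/funext => z; rewrite mulcJ.
Qed.

Let bw1 : cbounded (fun z => (normc (w z))%:C : R[i]).
Proof.
have [mw [M wM]] := bw; split; first by apply: cmeas_real; exact: cmeas_normc.
by exists M => z; rewrite normc_real ger0_norm ?normc_ge0.
Qed.

Let bb : cbounded (fun t => (b t)%:C). Proof. exact: bnd_real bw2. Qed.
Let ba : cbounded (fun t => (a t)%:C). Proof. exact: bnd_real bw1. Qed.
Let mb : measurable_fun [set: T] b. Proof. exact: bb.1.1. Qed.
Let ma : measurable_fun [set: T] a. Proof. exact: ba.1.1. Qed.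
Let b0 t : 0 <= b t. Proof. by apply: Rintegral_ge0 => x _; exact: sqr_ge0. Qed.
Let a0 t : 0 <= a t. Proof. by apply: Rintegral_ge0 => x _; exact: normc_ge0. Qed.

Let ib : nu.-integrable [set: T] (EFin \o b).
Proof. by have := integrable_Re (cbounded_integrable nu bb). Qed.
Let ia : nu.-integrable [set: T] (EFin \o a).
Proof. by have := integrable_Re (cbounded_integrable nu ba). Qed.

Let y : R := \int[nu]_t b t.
Let alpha : R := \int[nu]_t a t.

Let w2lty t : (\int[tau]_x (normc (w (t, x)) ^+ 2)%:E < +oo)%E.
Proof.
have := integrable_Re (cbounded_integrable tau (cbounded_section1 t bw2)).
move=> /integrableP[_]; apply: le_lt_trans.
by under [leRHS]eq_integral do rewrite /= ger0_norm ?sqr_ge0//.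
Qed.

Let bE t : (b t)%:E = (\int[tau]_x (normc (w (t, x)) ^+ 2)%:E)%E.
Proof.
rewrite /b /Rintegral fineK// ge0_fin_numE ?w2lty//.
by apply: integral_ge0 => x _; rewrite lee_fin sqr_ge0.
Qed.

Let yE : (y%:E = \int[(nu \x tau)%E]_z (\1_E z * normc (u z) ^+ 2)%:E)%E.
Proof.
under eq_integral do rewrite -w2E.
rewrite fubini_tonelli1 /fubini_F/=.
- under eq_integral do rewrite -bE.
  by rewrite /y /Rintegral fineK//; exact: integrable_fin_num ib.
- by apply/measurable_EFinP; apply: measurable_funX; apply: cmeas_normc; case: bw.
- by move=> z; rewrite lee_fin sqr_ge0.
Qed.

Let bessel_V t : \sum_i normc (V i t) ^+ 2 <= b t.
Proof.
rewrite -lee_fin bE.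
have bwJ := cboundedJ (bwt t).
have := @bessel _ _ _ tau I phi (fun x => (w (t, x))^*) bphi orth (bwJ.1).
under [X in (X < +oo)%E]eq_integral do rewrite normc_conjc.
under [X in (_ <= X)%E]eq_integral do rewrite normc_conjc.
move=> /(_ (w2lty t)); apply: le_trans; rewrite lee_fin; apply: ler_sum => i _.
have -> : cintegral tau (fun x => (w (t, x))^* * (phi i x)^*) =
    (cintegral tau (fun x => w (t, x) * phi i x))^*.
  rewrite -cintegralJ.
    by congr cintegral; apply/funext => x; rewrite -conjcM.
  exact: (cbounded_integrable tau (cboundedM (bwt t) (bphi i))).
rewrite normc_conjc /V normcM exprMn ler_piMr ?sqr_ge0//.
by rewrite expr_le1// normc_ge0.
Qed.

(* The kernel of the quadratic form whose double integral is the sum of the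
   squares of the integrals of the [V i]. *)
Let B t s : R[i] := \sum_i V i t * (V i s)^*.

Let VE i t : V i t = cintegral tau (fun x => w (t, x) * (om i t * phi i x)).
Proof.
rewrite /V -(cintegralZr (om i t) (cbounded_integrable tau (cboundedM (bwt t) (bphi i)))).
by congr cintegral; apply/funext => x; ring.
Qed.

Let VJE i s : (V i s)^* = cintegral tau (fun x => (w (s, x))^* * (om i s * phi i x)^*).
Proof.
have bop : cbounded (fun x => om i s * phi i x).
  by apply: cboundedM => //; exact: cbounded_cst.
rewrite VE -(cintegralJ (cbounded_integrable tau (cboundedM (bwt s) bop))).
by congr cintegral; apply/funext => x; rewrite -conjcM.
Qed.

Let B_small t s : kappa (t, s) < 1 -> normc (B t s) <= H * (a t * a s).
Proof.
move=> k1.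
have bop i r : cbounded (fun x => om i r * phi i x).
  by apply: cboundedM => //; exact: cbounded_cst.
pose inner x := \sum_i (om i t * phi i x) * (V i s)^*.
have binner : cbounded inner.
  by apply: cbounded_sum => i; apply: cboundedM => //; exact: cbounded_cst.
have innerH x : normc (inner x) <= H * a s.
  pose ker y := \sum_i (om i t * phi i x) * (om i s * phi i y)^*.
  have bker : cbounded ker.
    apply: cbounded_sum => i; apply: cboundedM; first exact: cbounded_cst.
    by apply: cboundedJ.
  have -> : inner x = cintegral tau (fun y => (w (s, y))^* * ker y).
    have bj i : cbounded (fun y => (w (s, y))^* * (om i s * phi i y)^*).
      by apply: cboundedM; exact: cboundedJ.
    rewrite (_ : (fun y => _) = fun y => \sum_i (om i t * phi i x) *
        ((w (s, y))^* * (om i s * phi i y)^*)).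
      rewrite cintegral_sum => [|i]; last first.
        by apply: cintegrableZ; exact: cbounded_integrable (bj i).
      apply: eq_bigr => i _.
      by rewrite VJE (cintegralZ (om i t * phi i x) (cbounded_integrable tau (bj i))).
    apply/funext => z; rewrite /ker mulr_sumr; apply: eq_bigr => i _.
    by rewrite mulrCA.
  apply: le_trans (normc_cintegralM_le tau (cboundedJ (bwt s)) bker (fun y => kernelH x y k1)) _.
  by rewrite /a; under eq_Rintegral do rewrite normc_conjc.
have -> : B t s = cintegral tau (fun x => w (t, x) * inner x).
  have bj i : cbounded (fun x => w (t, x) * (om i t * phi i x)) by exact: cboundedM.
  rewrite (_ : (fun x => _) = fun x => \sum_i (w (t, x) * (om i t * phi i x)) * (V i s)^*).
    rewrite cintegral_sum => [|i]; last first.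
      apply: cbounded_integrable; apply: cboundedM; first exact: bj.
      exact: cbounded_cst.
    apply: eq_bigr => i _.
    by rewrite VE (cintegralZr (V i s)^* (cbounded_integrable tau (bj i))).
  apply/funext => x; rewrite /inner mulr_sumr; apply: eq_bigr => i _.
  by rewrite mulrA.
apply: le_trans (normc_cintegralM_le tau (bwt t) binner innerH) _.
by rewrite -/(a t) -mulrA [a s * _]mulrC.
Qed.

Let B_large t s : normc (B t s) <= (b t + b s) / 2.
Proof.
apply: le_trans (ler_normc_sum _ _ _) _.
apply: (@le_trans _ _ (\sum_i (normc (V i t) ^+ 2 + normc (V i s) ^+ 2) / 2)).
  apply: ler_sum => i _; rewrite normcM normc_conjc.
  by have := sqr_ge0 (normc (V i t) - normc (V i s)); nra.
rewrite -mulr_suml big_split/=.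
by rewrite ler_pM2r ?invr_gt0// lerD ?bessel_V.
Qed.

Let z i : R[i] := cintegral nu (V i).
Let S : R := \sum_i normc (z i) ^+ 2.
Let G t : R[i] := \sum_i V i t * (z i)^*.

Let bVJ i : cbounded (fun s => (V i s)^*). Proof. exact: cboundedJ. Qed.

Let bG : cbounded G.
Proof.
by apply: cbounded_sum => i; apply: cboundedM; [exact: bV|exact: cbounded_cst].
Qed.

Let GE t : G t = cintegral nu (B t).
Proof.
rewrite /B (cintegral_sum (mu := nu)) => [|i]; last first.
  by apply: cintegrableZ; exact: cbounded_integrable (bVJ i).
apply: eq_bigr => i _.
rewrite (cintegralZ (V i t) (cbounded_integrable nu (bVJ i))).
by rewrite (cintegralJ (cbounded_integrable nu (bV i))).
Qed.

Let SE : (S%:C : R[i]) = cintegral nu G.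
Proof.
rewrite /G (cintegral_sum (mu := nu)) => [|i]; last first.
  apply: cbounded_integrable; apply: cboundedM; first exact: bV.
  exact: cbounded_cst.
rewrite /S (rmorph_sum (real_complex R)); apply: eq_bigr => i _.
by rewrite (cintegralZr (z i)^* (cbounded_integrable nu (bV i))) mulcJ.
Qed.

Let W t : \bar R :=
  ((H * alpha * a t)%:E + (m / 2 * b t)%:E + \int[nu]_s (kappa (t, s) * (b s / 2))%:E)%E.

Let mk1 t : measurable_fun [set: T] (fun s => kappa (t, s)).
Proof. exact: measurableT_comp mkappa _. Qed.

Let mkb : measurable_fun [set: T * T] (fun p : T * T => (kappa p * (b p.2 / 2))%:E).
Proof.
apply/measurable_EFinP; apply: measurable_funM => //.
by apply: measurable_funM => //; exact: measurableT_comp mb _.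
Qed.

Let kb0 p : (0 <= (kappa p * (b p.2 / 2))%:E)%E.
Proof. by rewrite lee_fin mulr_ge0// divr_ge0. Qed.

Let alpha0 : 0 <= alpha. Proof. exact: Rintegral_ge0. Qed.
Let y0 : 0 <= y. Proof. exact: Rintegral_ge0. Qed.

Let EyE : (\int[nu]_t (b t)%:E = y%:E)%E.
Proof. by rewrite /y /Rintegral fineK//; exact: integrable_fin_num ib. Qed.
Let EalphaE : (\int[nu]_t (a t)%:E = alpha%:E)%E.
Proof. by rewrite /alpha /Rintegral fineK//; exact: integrable_fin_num ia. Qed.

(* The bound [B_small] holds where [kappa < 1], and [B_large] elsewhere. *)
Let G_le t : ((normc (G t))%:E <= W t)%E.
Proof.
have bB : cbounded (B t).
  by apply: cbounded_sum => i; apply: cboundedM => //; exact: cbounded_cst.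
rewrite GE; apply: le_trans (normc_cintegral_lee (cbounded_integrable nu bB)) _.
have f1m : measurable_fun [set: T] (fun s => (H * a t * a s)%:E).
  by apply/measurable_EFinP; exact: measurable_funM.
have f2m : measurable_fun [set: T] (fun s => (b t / 2 * kappa (t, s))%:E).
  by apply/measurable_EFinP; apply: measurable_funM.
have f3m : measurable_fun [set: T] (fun s => (kappa (t, s) * (b s / 2))%:E).
  by apply/measurable_EFinP; apply: measurable_funM => //; apply: measurable_funM.
have f10 s : [set: T]%classic s -> (0 <= (H * a t * a s)%:E)%E.
  by rewrite lee_fin !mulr_ge0.
have f20 s : [set: T]%classic s -> (0 <= (b t / 2 * kappa (t, s))%:E)%E.
  by rewrite lee_fin mulr_ge0// divr_ge0.
have f30 s : [set: T]%classic s -> (0 <= (kappa (t, s) * (b s / 2))%:E)%E.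
  by move=> _; exact: kb0.
apply: (@le_trans _ _ (\int[nu]_s ((H * a t * a s)%:E +
   (b t / 2 * kappa (t, s))%:E + (kappa (t, s) * (b s / 2))%:E))%E).
  apply: ge0_le_integral; first exact: measurableT.
  - by move=> s _; rewrite lee_fin normc_ge0.
  - by apply: measurable_normc_EFin; case: bB.
  - by apply: emeasurable_funD => //; exact: emeasurable_funD.
  - move=> s _; rewrite -!EFinD lee_fin.
    have := B_large t s; have k0 := kappa0 (t, s).
    have bt := b0 t; have bs := b0 s.
    have [k1|k1] := ltP (kappa (t, s)) 1.
      move=> _; apply: le_trans (B_small k1) _; rewrite mulrA -addrA lerDl.
      by rewrite addr_ge0 ?mulr_ge0 ?divr_ge0.
    move=> Bl; apply: le_trans Bl _.
    have : 0 <= H * a t * a s by rewrite !mulr_ge0.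
    by nra.
rewrite ge0_integralD//=; last 2 first.
  by move=> s _; rewrite adde_ge0//; [exact: f10|exact: f20].
  exact: emeasurable_funD.
rewrite ge0_integralD//= /W leeD2r// leeD//.
  rewrite ge0_integralZl_real ?mulr_ge0//.
  by rewrite EalphaE -EFinM lee_fin mulrAC.
rewrite ge0_integralZl_real ?divr_ge0//.
apply: (@le_trans _ _ ((b t / 2)%:E * m%:E)%E).
  by rewrite lee_wpmul2l// lee_fin divr_ge0.
by rewrite -EFinM lee_fin; have := b0 t; lra.
Qed.

Let S_le : S <= H * alpha ^+ 2 + m * y.
Proof.
have S0 : 0 <= S by apply: sumr_ge0 => i _; exact: sqr_ge0.
have -> : S = normc (cintegral nu G) by rewrite -SE normc_real ger0_norm.
rewrite -lee_fin.
apply: le_trans (normc_cintegral_lee (cbounded_integrable nu bG)) _.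
have mF : measurable_fun [set: T] (fun t => \int[nu]_s (kappa (t, s) * (b s / 2))%:E)%E.
  exact: (measurable_fun_fubini_tonelli_F (m2 := nu) _ mkb kb0).
have F0 t : (0 <= \int[nu]_s (kappa (t, s) * (b s / 2))%:E)%E.
  by apply: integral_ge0 => s _; exact: kb0.
have g1m : measurable_fun [set: T] (fun t => (H * alpha * a t)%:E).
  by apply/measurable_EFinP; exact: measurable_funM.
have g2m : measurable_fun [set: T] (fun t => (m / 2 * b t)%:E).
  by apply/measurable_EFinP; exact: measurable_funM.
have g10 t : [set: T]%classic t -> (0 <= (H * alpha * a t)%:E)%E.
  by rewrite lee_fin !mulr_ge0.
have g20 t : [set: T]%classic t -> (0 <= (m / 2 * b t)%:E)%E.
  by rewrite lee_fin mulr_ge0// divr_ge0.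
apply: (@le_trans _ _ (\int[nu]_t W t)%E).
  apply: ge0_le_integral; first exact: measurableT.
  - by move=> t _; rewrite lee_fin normc_ge0.
  - by apply: measurable_normc_EFin; case: bG.
  - by apply: emeasurable_funD => //; exact: emeasurable_funD.
  - by move=> t _; exact: G_le.
rewrite /W ge0_integralD//=; last 2 first.
  by move=> t _; rewrite adde_ge0//; [exact: g10|exact: g20].
  exact: emeasurable_funD.
rewrite ge0_integralD//=.
have -> : (\int[nu]_t (H * alpha * a t)%:E = (H * alpha ^+ 2)%:E)%E.
  rewrite ge0_integralZl_real ?mulr_ge0//.
  by rewrite EalphaE -EFinM -mulrA.
have -> : (\int[nu]_t (m / 2 * b t)%:E = (m / 2 * y)%:E)%E.
  rewrite ge0_integralZl_real ?divr_ge0//.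
  by rewrite EyE -EFinM.
have swap : (\int[nu]_t \int[nu]_s (kappa (t, s) * (b s / 2))%:E <= (m / 2 * y)%:E)%E.
  rewrite [leLHS](fubini_tonelli (m1 := nu) (m2 := nu) _ mkb kb0) /fubini_G/=.
  apply: (@le_trans _ _ (\int[nu]_s (m / 2 * b s)%:E)%E).
    apply: ge0_le_integral; first exact: measurableT.
    - by move=> s _; apply: integral_ge0 => t _; exact: kb0.
    - exact: (measurable_fun_fubini_tonelli_G (m1 := nu) _ mkb kb0).
    - by apply/measurable_EFinP; exact: measurable_funM.
    - move=> s _; under eq_integral do rewrite mulrC.
      rewrite ge0_integralZl_real ?divr_ge0//; last exact: measurableT_comp mkappa _.
      apply: (@le_trans _ _ ((b s / 2)%:E * m%:E)%E).
        by rewrite lee_wpmul2l// lee_fin divr_ge0.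
      by rewrite -EFinM lee_fin; have := b0 s; lra.
  rewrite ge0_integralZl_real ?divr_ge0//.
  by rewrite EyE -EFinM.
apply: le_trans (leeD2l _ swap) _.
by rewrite -!EFinD lee_fin; lra.
Qed.

Let alpha_le : lam * alpha <= y.
Proof.
rewrite /alpha /y -RintegralZl//.
apply: le_Rintegral => //; first exact: integrable_scale.
move=> t _; have iw1 := integrable_normc (cbounded_integrable tau (bwt t)).
rewrite /a /b -RintegralZl//; apply: le_Rintegral => //.
- exact: integrable_scale.
- by have := integrable_Re (cbounded_integrable tau (cbounded_section1 t bw2)).
- move=> x _; rewrite w2E /w normcM normc_real normc_conjc indicE.
  case: (boolP (_ \in _)) => [|_]; last by rewrite normr0 !mul0r mulr0.
  rewrite inE /E/= normr1 !mul1r expr2 => uE.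
  by rewrite ler_wpM2r ?normc_ge0// ltW.
Qed.

(* Integrate [w * u = |w|^2]. *)
Let y_pairing : (y%:C : R[i]) = \sum_i c i * z i.
Proof.
have -> : (y%:C : R[i]) = cintegral nu (fun t => (b t)%:C).
  by apply/eqP; rewrite eq_complex/= eqxx/= Rintegral_cst// mul0r.
rewrite (_ : (fun t => _) = fun t => \sum_i c i * V i t).
  rewrite cintegral_sum => [|i]; last first.
    by apply: cintegrableZ; exact: cbounded_integrable (bV i).
  by apply: eq_bigr => i _; rewrite (cintegralZ (c i) (cbounded_integrable nu (bV i))).
apply/funext => t.
have -> : ((b t)%:C : R[i]) = cintegral tau (fun x => w (t, x) * u (t, x)).
  rewrite (_ : (fun x => w (t, x) * _) = fun x => (normc (w (t, x)) ^+ 2)%:C).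
    by apply/eqP; rewrite eq_complex/= eqxx/= Rintegral_cst// mul0r.
  by apply/funext => x; rewrite wuE.
have bop i : cbounded (fun x => w (t, x) * (om i t * phi i x)).
  apply: cboundedM; first exact: bwt.
  by apply: cboundedM => //; exact: cbounded_cst.
rewrite (_ : (fun x => _) = fun x => \sum_i c i * (w (t, x) * (om i t * phi i x))).
  rewrite cintegral_sum => [|i]; last first.
    by apply: cintegrableZ; exact: cbounded_integrable (bop i).
  apply: eq_bigr => i _.
  by rewrite VE (cintegralZ (c i) (cbounded_integrable tau (bop i))).
apply/funext => x; rewrite /u mulr_sumr; apply: eq_bigr => i _.
by rewrite mulrCA.
Qed.

(** The hypothesis [2 * A^2 * H <= lam^2] allows the part of the double integral
    where the kernel is at most [H] to be absorbed: on the level set,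
    [lam * |u| <= |u|^2], so that this part is at most half of the square of the
    left-hand side. *)
Lemma level_set_le : 0 < A ->
  (\int[(nu \x tau)%E]_p ((\1_E p : R) * normc (u p) ^+ 2)%:E <= (2 * A ^+ 2 * m)%:E)%E.
Proof.
move=> A0; rewrite -yE lee_fin.
have [y00|yn0] := eqVneq y 0; first by rewrite y00 mulr_ge0// mulr_ge0// sqr_ge0.
have yp : 0 < y by rewrite lt_def yn0.
have A2 : 0 < A ^+ 2 by rewrite exprn_gt0.
(* Cauchy-Schwarz for the pairing, in the form of a weighted inequality
   between the arithmetic and the geometric mean. *)
have yS : y ^+ 2 <= A ^+ 2 * S.
  pose e := y / A ^+ 2; have e0 : 0 < e by rewrite divr_gt0.
  have : 2 * y <= \sum_i (e * normc (c i) ^+ 2 + e^-1 * normc (z i) ^+ 2).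
    have -> : y = normc (\sum_i c i * z i) by rewrite -y_pairing normc_real ger0_norm.
    apply: le_trans (ler_wpM2l _ (ler_normc_sum _ _ _)) _ => //.
    rewrite mulr_sumr; apply: ler_sum => i _; rewrite normcM.
    set p := normc (c i); set q := normc (z i).
    have : 0 <= e * (p - e^-1 * q) ^+ 2 by rewrite mulr_ge0 ?sqr_ge0// ltW.
    have -> : e * (p - e^-1 * q) ^+ 2 = e * p ^+ 2 + e^-1 * q ^+ 2 - 2 * (p * q).
      by field; rewrite gt_eqF.
    by lra.
  rewrite big_split/= -!mulr_sumr -/S => H1.
  have H2 : e * \sum_i normc (c i) ^+ 2 <= y.
    apply: le_trans (ler_wpM2l (ltW e0) cA) _.
    by rewrite /e divfK// gt_eqF.
  have H3 : y <= e^-1 * S by lra.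
  move: H3; rewrite /e invf_div mulrAC ler_pdivlMr//.
have la : lam ^+ 2 * alpha ^+ 2 <= y ^+ 2.
  rewrite -exprMn; apply: lerXn2r alpha_le; rewrite nnegrE; last exact: y0.
  by apply: mulr_ge0; [exact: ltW|exact: alpha0].
have H1 : 2 * A ^+ 2 * H * alpha ^+ 2 <= y ^+ 2.
  by apply: le_trans (ler_wpM2r _ AH) la; exact: sqr_ge0.
have H2 := ler_wpM2l (ltW A2) S_le.
have : y * y <= 2 * A ^+ 2 * m * y by rewrite -expr2; lra.
by rewrite ler_pM2r.
Qed.

End level_set.

(** * From level sets to Lebesgue norms *)
Lemma powR_exprn {R : realType} (x e : R) (i : nat) : 0 <= x ->
  (x ^+ i) `^ e = (x `^ e) ^+ i.
Proof.
by move=> x0; rewrite -[x ^+ i]powR_mulrn// powRAC powR_mulrn ?powR_ge0.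
Qed.

Lemma powR_invE {R : realType} (x e : R) : 0 <= x -> x^-1 `^ e = x `^ (- e).
Proof. by move=> x0; rewrite -powR_inv1// -powRrM mulN1r. Qed.

Section dyadic_layers.
Context {R : realType} {dT : measure_display} {T : measurableType dT}.
Variables (mu : {measure set T -> \bar R}) (g : T -> R) (s tau La Q : R).
Hypotheses (mu_fin : (mu [set: T]%classic < +oo)%E) (mg : measurable_fun [set: T] g).
Hypotheses (g0 : forall x, 0 <= g x) (gLa : forall x, g x <= La) (La0 : 0 < La).
Hypotheses (tau0 : 0 <= tau) (taus : tau < s) (Q0 : 0 <= Q).

Let E (l : R) : set T := [set x | l < g x].
Hypothesis layer : forall l, 0 < l ->
  (\int[mu]_x ((\1_(E l) x : R) * g x ^+ 2)%:E <= (Q * l `^ (- tau))%:E)%E.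

Let h (i : nat) : R := 2^-1 ^+ i * La.

Let h0 i : 0 < h i. Proof. by rewrite mulr_gt0// exprn_gt0. Qed.

Let s0 : 0 <= s. Proof. by rewrite (le_trans tau0)// ltW. Qed.

Let mE l : measurable (E l).
Proof.
rewrite (_ : E l = (g @^-1` `]l, +oo[)%classic).
  by rewrite -[X in measurable X]setTI; exact: mg.
by apply/seteqP; split => z /=; rewrite in_itv/= andbT.
Qed.

(* The remainder [h J `^ s] accounts for the points below the lowest layer; it
   is made arbitrarily small in the end. *)
Let powR_layers x J :
  g x `^ s <= h J `^ s + \sum_(0 <= i < J) h i `^ s * \1_(E (h i.+1)) x.
Proof.
have sum0 r : 0 <= \sum_(0 <= i < r) h i `^ s * \1_(E (h i.+1)) x.
  by apply: sumr_ge0 => i _; rewrite mulr_ge0 ?powR_ge0// indicE ler0n.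
have mono a b : 0 <= a -> a <= b -> a `^ s <= b `^ s.
  by move=> a0 ab; apply: ge0_ler_powR; rewrite ?nnegrE// (le_trans a0).
elim: J => [|J IH].
  by rewrite big_geq// addr0 /h expr0 mul1r mono.
have [gh|hg] := leP (g x) (h J.+1).
  by rewrite (le_trans (mono _ _ _ gh))// lerDl.
apply: le_trans IH _; rewrite big_nat_recr//= indicE.
have -> : x \in E (h J.+1) by rewrite inE.
by rewrite mulr1; have := powR_ge0 (h J.+1) s; lra.
Qed.

Let kap : R := 2 `^ (- (s - tau)).

Let kap01 : 0 < kap < 1.
Proof.
rewrite powR_gt0//= /kap powRN invf_lt1 ?powR_gt0//.
rewrite /powR pnatr_eq0/= -[ltLHS]expR0 ltr_expR mulr_gt0 ?subr_gt0//.
by rewrite ln_gt0 ?ltr1n.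
Qed.

Let layer_weight i : h i `^ s * h i.+1 `^ (- tau) =
  2 `^ tau * La `^ (s - tau) * kap ^+ i.
Proof.
have two0 : 0 < 2 :> R by [].
have pw (e : R) : (2^-1 ^+ i : R) `^ e = (2 `^ (- e)) ^+ i.
  by rewrite powR_exprn ?invr_ge0// powR_invE.
have hS : h i.+1 = 2^-1 * h i by rewrite /h exprS mulrA.
rewrite hS [(2^-1 * h i) `^ _]powRM ?invr_ge0 ?(ltW (h0 i))//.
have -> : (2^-1 : R) `^ (- tau) = 2 `^ tau.
  by rewrite powR_invE// opprK.
have -> : h i `^ s * (2 `^ tau * h i `^ (- tau)) =
    2 `^ tau * h i `^ (s - tau).
  rewrite powRD; last by apply/implyP => _; rewrite gt_eqF.
  by ring.
by rewrite /h powRM ?exprn_ge0 ?invr_ge0 ?(ltW La0)// pw /kap; ring.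
Qed.

(** The layer at height [h i] contributes a multiple of [(h i)^(s - tau)]; as
    [tau < s], the sum is geometric and dominated by the top height [La]. *)
Lemma dyadic_layers_le :
  (\int[mu]_x (g x `^ (s + 2))%:E <=
    (2 `^ tau * Q * (1 - kap)^-1 * La `^ (s - tau))%:E)%E.
Proof.
set X := _ * La `^ _.
have [m mE'] : exists m : R, mu [set: T]%classic = m%:E.
  by exists (fine (mu [set: T]%classic)); rewrite fineK// ge0_fin_numE.
have m0 : 0 <= m by rewrite -lee_fin -mE'.
have mind i : measurable_fun [set: T] (\1_(E (h i.+1)) : T -> R).
  by apply: measurable_indic.
have bound J : (\int[mu]_x (g x `^ (s + 2))%:E <=
    X%:E + (h J `^ s * (La ^+ 2 * m))%:E)%E.
  apply: (@le_trans _ _ (\int[mu]_x ((h J `^ s * La ^+ 2)%:E +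
      \sum_(i <- index_iota 0 J) (h i `^ s * (\1_(E (h i.+1)) x * g x ^+ 2))%:E))%E).
    apply: ge0_le_integral; first exact: measurableT.
    - by move=> x _; rewrite lee_fin powR_ge0.
    - apply/measurable_EFinP.
      by apply: (measurableT_comp (measurable_powR (s + 2))).
    - apply: emeasurable_funD => //; apply: emeasurable_sum => i.
      apply/measurable_EFinP; apply: measurable_funM => //.
      by apply: measurable_funM => //; exact: measurable_funX.
    - move=> x _; rewrite sumEFin -EFinD lee_fin.
      have -> : g x `^ (s + 2) = g x `^ s * g x ^+ 2.
        have [gx0|gx0] := eqVneq (g x) 0.
          by rewrite gx0 expr0n/= mulr0 powR0// gt_eqF// ltr_wpDl.
        rewrite powRD; last by apply/implyP => _.
        by rewrite powR_mulrn.
      apply: le_trans (ler_wpM2r (sqr_ge0 _) (powR_layers x J)) _.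
      rewrite mulrDl mulr_suml lerD//.
        by rewrite ler_wpM2l ?powR_ge0// ler_pXn2r ?nnegrE// ltW.
      by apply: ler_sum => i _; rewrite -mulrA.
  rewrite ge0_integralD//=; last 2 first.
    by move=> x _; apply: sume_ge0 => i _; rewrite lee_fin !mulr_ge0 ?powR_ge0// ?indicE ?sqr_ge0.
    apply: emeasurable_sum => i.
    apply/measurable_EFinP; apply: measurable_funM => //.
    by apply: measurable_funM => //; exact: measurable_funX.
  rewrite integral_cst// mE' -EFinM -mulrA addeC leeD2r//.
  rewrite ge0_integral_sum//; last 2 first.
    move=> i; apply/measurable_EFinP; apply: measurable_funM => //.
    by apply: measurable_funM => //; exact: measurable_funX.
    by move=> i x _; rewrite lee_fin !mulr_ge0 ?powR_ge0// ?indicE ?sqr_ge0.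
  apply: (@le_trans _ _ (\sum_(i <- index_iota 0 J)
      (Q * (2 `^ tau * La `^ (s - tau)) * kap ^+ i)%:E)%E).
    apply: lee_sum => i _.
    under eq_integral do rewrite EFinM.
    rewrite ge0_integralZl_EFin ?powR_ge0//; last 2 first.
      by move=> x _; rewrite lee_fin mulr_ge0// ?indicE ?sqr_ge0.
      by apply/measurable_EFinP; apply: measurable_funM => //; exact: measurable_funX.
    apply: (@le_trans _ _ ((h i `^ s)%:E * (Q * h i.+1 `^ (- tau))%:E)%E).
      by rewrite lee_wpmul2l ?lee_fin ?powR_ge0//; exact: layer.
    by rewrite -EFinM lee_fin mulrCA layer_weight -!mulrA lexx.
  rewrite sumEFin lee_fin -mulr_sumr.
  have /andP[k0 k1] := kap01.
  have geo : \sum_(0 <= i < J) kap ^+ i <= (1 - kap)^-1.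
    rewrite -[leRHS]mul1r ler_pdivlMr ?subr_gt0// mulrC.
    rewrite big_mkord -opprB mulNr -subrX1 opprB gerBl exprn_ge0//.
    exact: ltW.
  have W0 : 0 <= Q * (2 `^ tau * La `^ (s - tau)) by rewrite !mulr_ge0 ?powR_ge0.
  have := ler_wpM2l W0 geo; rewrite /X; lra.
  by move=> _ _; rewrite lee_fin mulr_ge0 ?powR_ge0 ?sqr_ge0.
apply/lee_addgt0Pr => e e0.
have s_gt0 : 0 < s by rewrite (le_lt_trans tau0).
pose k2 : R := 2 `^ (- s).
have k20 : 0 < k2 by rewrite powR_gt0.
have k21 : k2 < 1.
  rewrite /k2 powRN invf_lt1 ?powR_gt0// /powR pnatr_eq0/= -[ltLHS]expR0 ltr_expR.
  by rewrite mulr_gt0// ln_gt0 ?ltr1n.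
pose Z := La `^ s * (La ^+ 2 * m).
have Z0 : 0 <= Z by rewrite mulr_ge0 ?powR_ge0// mulr_ge0// sqr_ge0.
have [J kJ] : exists J, k2 ^+ J * Z <= e.
  have e1 : 0 < e / (Z + 1) by rewrite divr_gt0// ltr_wpDl.
  have := @cvg_expr _ k2; rewrite gtr0_norm// => /(_ k21).
  move=> /cvgr0Pnorm_lt /(_ _ e1) [J _ /(_ J (leqnn J))] /= HJ.
  exists J; have kk : k2 ^+ J <= e / (Z + 1).
    by apply: le_trans (ltW HJ); exact: ler_norm.
  apply: le_trans (ler_wpM2r Z0 kk) _.
  rewrite mulrAC ler_pdivrMr ?ltr_wpDl// ler_pM2l//; lra.
apply: le_trans (bound J) _; rewrite -!EFinD lee_fin lerD2l.
suff -> : h J `^ s * (La ^+ 2 * m) = k2 ^+ J * Z by [].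
rewrite /h powRM ?exprn_ge0 ?invr_ge0 ?(ltW La0)//.
have -> : (2^-1 ^+ J : R) `^ s = k2 ^+ J.
  by rewrite powR_exprn ?invr_ge0// powR_invE.
by rewrite /Z -mulrA.
Qed.

End dyadic_layers.

(** * Characters of the torus *)
Section fubini_complex.
Context {R : realType} {d1 d2 : measure_display}.
Context {T : measurableType d1} {X : measurableType d2}.
Variables (nu : {finite_measure set T -> \bar R}) (tau : {finite_measure set X -> \bar R}).

Lemma cintegral_prod (h : T * X -> R[i]) : cbounded h ->
  cintegral (nu \x tau)%E h = cintegral nu (fun t => cintegral tau (fun x => h (t, x))).
Proof.
move=> bh; have [mh [M hM]] := bh.
have ih : cintegrable (nu \x tau)%E h.
  apply: (@le_cintegrable _ _ _ _ _ (fun=> M)) => //.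
  apply: measurable_bounded_integrable => //; first exact: product_measure_lty.
  exact: bounded_cst.
have E (f : T * X -> R) : (nu \x tau)%E.-integrable [set: T * X]%classic (EFin \o f) ->
    (forall t, tau.-integrable [set: X]%classic (EFin \o (fun x => f (t, x)))) ->
    \int[(nu \x tau)%E]_z f z = \int[nu]_t \int[tau]_x f (t, x).
  move=> ifz ift; rewrite /Rintegral -(integral12_prod_meas1 ifz) /fubini_F/=.
  congr fine; apply: eq_integral => t _.
  by rewrite fineK//; exact: integrable_fin_num (ift t).
apply/eqP; rewrite eq_complex/= !E ?eqxx//.
- exact: integrable_Im ih.
- by move=> t; exact: integrable_Im (cbounded_integrable tau (cbounded_section1 t bh)).
- exact: integrable_Re ih.
- by move=> t; exact: integrable_Re (cbounded_integrable tau (cbounded_section1 t bh)).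
Qed.

End fubini_complex.

Section characters.
Context {R : realType}.
Local Notation e := (@expi2pi R).

(** The factor of [torus_measure], with its type of probability law. *)
Definition unit_law : probability (measurableTypeR R) R := uniform_prob (@ltr01 R).

Local Notation U := unit_law.

Lemma cintegral_probability_cst {dT} {T : measurableType dT} (P : probability T R)
    (c : R[i]) : cintegral P (fun=> c) = c.
Proof.
case: c => a b; rewrite /cintegral/= !Rintegral_cst//.
by rewrite [X in fine X](_ : _ = 1%E) ?mulr1//; exact: probability_setT.
Qed.

(** Adding 1 to the sine or cosine makes it nonnegative, so that the integral
    for the uniform law reduces to the fundamental theorem of calculus. *)
Lemma Rintegral_uniform_FTC (f F : R -> R) : continuous f ->
  (forall x, -1 <= f x <= 1) -> (forall x : R, is_derive x 1 F (1 + f x)) ->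
  \int[U]_x f x = F 1 - F 0 - 1.
Proof.
move=> cf f1 dF.
have mf : measurable_fun [set: measurableTypeR R] f by exact: continuous_measurable_fun.
have m1f : measurable_fun [set: measurableTypeR R] (fun x => 1 + f x).
  exact: measurable_funD.
have U1 : (U [set: measurableTypeR R]%classic = 1)%E by exact: probability_setT.
have Ulty : (U [set: measurableTypeR R]%classic < +oo)%E by rewrite U1 ltry.
have iuf : U.-integrable [set: measurableTypeR R]%classic (EFin \o f).
  apply: measurable_bounded_integrable => //.
  exists 1; split; first exact: num_real.
  by move=> M M1 x _ /=; rewrite (le_trans _ (ltW M1))// ler_norml.
have i1 : U.-integrable [set: measurableTypeR R]%classic (EFin \o (fun=> 1 : R)).
  exact: finite_measure_integrable_cst.
have -> : \int[U]_x f x = \int[U]_x (1 + f x) - 1.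
  rewrite RintegralD// Rintegral_cst//.
  rewrite [X in fine X](_ : _ = 1%E)//= mulr1.
  by ring.
congr (_ - 1); rewrite /Rintegral (integral_uniform (@ltr01 R)); last 2 first.
- exact/measurable_EFinP.
- by move=> x; rewrite lee_fin; have /andP[? _] := f1 x; lra.
rewrite subr0 invr1 mul1e (@continuous_FTC2 _ _ F)//.
- apply: continuous_subspaceT => x; apply: cvgD; [exact: cvg_cst|exact: cf].
- split.
  + by move=> x _; have [] := dF x.
  + apply: cvg_at_right_filter; apply: differentiable_continuous.
    by apply/derivable1_diffP; have [] := dF 0.
  + apply: cvg_at_left_filter; apply: differentiable_continuous.
    by apply/derivable1_diffP; have [] := dF 1.
- by move=> x _; rewrite derive1E; have [] := dF x.
Qed.

Lemma cintegral_uniform_character (k : int) :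
  cintegral U (fun x : measurableTypeR R => e (k%:~R * x)) = (k == 0)%:R.
Proof.
have [->|k0] := eqVneq k 0.
  rewrite (_ : (fun x => _) = fun=> 1).
    exact: cintegral_probability_cst.
  by apply/funext => x; rewrite mul0r expi2pi0.
pose c : R := 2 * pi * k%:~R.
have c0 : c != 0.
  apply: mulf_neq0; last by rewrite intr_eq0.
  by rewrite mulf_neq0// gt_eqF// pi_gt0.
have ec x : 2 * pi * (k%:~R * x) = c * x by rewrite mulrA.
have cc1 : cos c = 1 /\ sin c = 0.
  have := expi2pi_int (k : int) (R := R); rewrite /expi2pi -/c => /eqP.
  by rewrite eq_complex/= => /andP[/eqP -> /eqP ->].
have [cos1 sin1] := cc1.
have cz : continuous (fun x : R => c * x) by exact: mulrl_continuous.
apply/eqP; rewrite eq_complex/=; apply/andP; split; apply/eqP.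
- under eq_Rintegral do rewrite ec.
  have dF (x : R) : is_derive x 1 (fun x : R => x + c^-1 * sin (c * x)) (1 + cos (c * x)).
    apply: is_derive_eq; rewrite /GRing.scale/=; field.
    by rewrite ?c0.
  have cc : continuous (fun x : R => cos (c * x)).
    by move=> x; apply: continuous_comp; [exact: cz|exact: continuous_cos].
  have bc (x : R) : -1 <= cos (c * x) <= 1 by rewrite cos_geN1 cos_le1.
  rewrite (Rintegral_uniform_FTC cc bc dF).
  by rewrite mulr0 mulr1 sin0 sin1; ring.
- under eq_Rintegral do rewrite ec.
  have dF (x : R) : is_derive x 1 (fun x : R => x - c^-1 * cos (c * x)) (1 + sin (c * x)).
    apply: is_derive_eq; rewrite /GRing.scale/=; field.
    by rewrite ?c0.
  have cc : continuous (fun x : R => sin (c * x)).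
    by move=> x; apply: continuous_comp; [exact: cz|exact: continuous_sin].
  have bc (x : R) : -1 <= sin (c * x) <= 1 by rewrite sin_geN1 sin_le1.
  rewrite (Rintegral_uniform_FTC cc bc dF).
  by rewrite mulr0 mulr1 cos0 cos1; ring.
Qed.

Lemma cintegral_distribution {d1 d2} {T : measurableType d1} {X : measurableType d2}
    (P : probability T R) (Z : {RV P >-> X}) (g : X -> R[i]) : cbounded g ->
  cintegral (distribution P Z) g = cintegral P (g \o Z).
Proof.
move=> bg; have [mg [M gM]] := bg.
have bgZ : cbounded (g \o Z).
  by split; [split; [exact: measurableT_comp mg.1 _|exact: measurableT_comp mg.2 _]|
             exists M => x; exact: gM].
have igZ := cbounded_integrable P bgZ.
apply/eqP; rewrite eq_complex/= /Rintegral !integral_distribution ?eqxx//.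
- by apply/measurable_EFinP; case: mg.
- exact: integrable_Im igZ.
- by apply/measurable_EFinP; case: mg.
- exact: integrable_Re igZ.
Qed.

Lemma measurable_linear_form (d : nat) (k : 'I_d -> R) :
  measurable_fun [set: Rd R d] (fun x => \sum_j k j * (tnth x j : R)).
Proof.
apply: measurable_sum => j; apply: measurable_funM => //.
exact: measurable_tnth.
Qed.

(** By induction on the dimension: Fubini splits off one coordinate. *)
Lemma cintegral_torus_character (d : nat) (k : 'I_d -> int) :
  cintegral (torus_measure R d)
    (fun x => e (\sum_j (k j)%:~R * (tnth x j : R))) = [forall j, k j == 0]%:R.
Proof.
have bch r (l : 'I_r -> int) :
    cbounded (fun x : Rd R r => e (\sum_j (l j)%:~R * (tnth x j : R))).
  by apply: cbounded_expi2pi; exact: measurable_linear_form.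
elim: d k => [|d IH] k.
  have -> : [forall j : 'I_0, k j == 0] by apply/forallP => -[].
  rewrite (_ : (fun x => _) = fun=> 1).
    exact: cintegral_probability_cst.
  by apply/funext => x; rewrite big_ord0 expi2pi0.
rewrite /= cintegral_distribution; last exact: bch.
rewrite [LHS](cintegral_prod unit_law (torus_measure R d)); last first.
  have [mb [M bM]] := bch _ k; split; last by exists M => x; exact: bM.
  by split; [exact: measurableT_comp mb.1 _|exact: measurableT_comp mb.2 _].
pose kt (j : 'I_d) := k (lift ord0 j).
rewrite (_ : (fun t => _) = fun t : measurableTypeR R =>
    e ((k ord0)%:~R * t) * ([forall j, kt j == 0]%:R)).
  rewrite cintegralZr; last first.
    by apply: cbounded_integrable; apply: cbounded_expi2pi; exact: measurable_funM.
  rewrite cintegral_uniform_character -natrM mulnb; congr (nat_of_bool _)%:R.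
  apply/andP/forallP => [[k0 /forallP kj] j|kj]; last by split; [|apply/forallP => j]; exact: kj.
  by case: (unliftP ord0 j) => [i ->|->]; [exact: kj|].
apply/funext => t; rewrite -IH -cintegralZ; last exact: cbounded_integrable (bch _ _).
congr cintegral; apply/funext => x; rewrite /= big_ord_recl -expi2piD/=.
by congr (e (_ + _)); apply: eq_bigr => j _; rewrite tnthS.
Qed.

End characters.

(** * The time interval *)
Section time_interval.
Context {R : realType}.

(** The first factor of [spacetime_measure], named in order to carry a structure
    of finite measure. *)
Definition time_measure (a b : R) : set (measurableTypeR R) -> \bar R :=
  mrestr (@lebesgue_measure R) (measurable_itv `[a, b]%R).

HB.instance Definition _ (a b : R) := Measure.on (time_measure a b).

Lemma time_measure_fin_num (a b : R) : fin_num_fun (time_measure a b).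
Proof.
move=> X mX; rewrite ge0_fin_numE ?measure_ge0//.
apply: (@le_lt_trans _ _ (lebesgue_measure [set` `[a, b]%R])).
  by apply: le_measure; [rewrite inE; exact: measurableI|rewrite inE|exact: subIsetr].
rewrite lebesgue_measure_itv/=; case: ifP => _; last exact: ltry.
by rewrite -EFinB ltry.
Qed.

HB.instance Definition _ (a b : R) :=
  Measure_isFinite.Build _ _ _ (time_measure a b) (@time_measure_fin_num a b).

Lemma time_measure_ball (a b c r : R) : 0 <= r ->
  (time_measure a b [set x : R | (`|x - c| <= r)%R]%classic <= (2 * r)%:E)%E.
Proof.
move=> r0.
have -> : [set x : R | `|x - c| <= r]%classic = [set` `[c - r, c + r]%R]%classic.
  by apply/seteqP; split => x /=; rewrite in_itv/= ler_distl.
apply: (@le_trans _ _ (lebesgue_measure [set` `[c - r, c + r]%R])).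
  by apply: le_measure; [rewrite inE; exact: measurableI|rewrite inE|exact: subIsetl].
rewrite lebesgue_measure_itv/=; case: ifP => _; last by rewrite lee_fin mulr_ge0.
by rewrite -EFinB lee_fin; lra.
Qed.

Definition interval_count (s : seq (R * R)) (p : measurableTypeR R * measurableTypeR R) : R :=
  \sum_(i <- s) \1_[set q : R * R | `|q.1 - q.2 - i.1| <= i.2]%classic p.

Lemma measurable_dist_set (i : R * R) :
  measurable [set q : measurableTypeR R * measurableTypeR R |
    (`|(q.1 : R) - q.2 - i.1| <= i.2)%R]%classic.
Proof.
pose f (q : measurableTypeR R * measurableTypeR R) : R := `|(q.1 : R) - q.2 - i.1|.
have mf : measurable_fun [set: measurableTypeR R * measurableTypeR R]%classic f.
  apply: measurableT_comp => //; apply: measurable_funB => //.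
  by apply: measurable_funB.
rewrite (_ : mkset _ = (f @^-1` `]-oo, i.2])%classic).
  by rewrite -[X in measurable X]setTI; exact: mf.
by apply/seteqP; split => q /=; rewrite in_itv.
Qed.

Lemma measurable_interval_count s :
  measurable_fun [set: measurableTypeR R * measurableTypeR R] (interval_count s).
Proof.
rewrite /interval_count; apply: measurable_sum => i.
by apply: measurable_indic; exact: measurable_dist_set.
Qed.

Lemma interval_count_ge0 s p : 0 <= interval_count s p.
Proof. by apply: sumr_ge0 => i _; rewrite indicE ler0n. Qed.

Lemma interval_count_lt1 s (t u : R) : interval_count s (t, u) < 1 ->
  forall i, i \in s -> i.2 < `|t - u - i.1|.
Proof.
move=> lt1 i si; rewrite ltNge; apply/negP => ile; move: lt1.
rewrite ltNge => /negP; apply.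
rewrite /interval_count (perm_big _ (perm_to_rem si))/= big_cons indicE.
rewrite mem_set//= lerDl; apply: sumr_ge0 => j _; rewrite indicE ler0n//.
Qed.

Lemma measurable_ball_set (c r : R) :
  measurable [set x : measurableTypeR R | (`|(x : R) - c| <= r)%R]%classic.
Proof.
have -> : [set x : R | `|x - c| <= r]%classic = [set` `[c - r, c + r]%R]%classic.
  by apply/seteqP; split => x /=; rewrite in_itv/= ler_distl.
exact: measurable_itv.
Qed.

Lemma integral_ball_count (a b : R) (s : seq (R * R)) (ctr : R * R -> R) :
  (forall i, i \in s -> 0 <= i.2) ->
  (\int[time_measure a b]_x (\sum_(i <- s)
      \1_[set x : measurableTypeR R | (`|(x : R) - ctr i| <= i.2)%R]%classic x)%:E <=
    (2 * \sum_(i <- s) i.2)%:E)%E.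
Proof.
move=> s0; under eq_integral do rewrite -sumEFin.
rewrite ge0_integral_sum//; last first.
  move=> i; apply/measurable_EFinP.
  by apply: measurable_indic; exact: measurable_ball_set.
rewrite mulr_sumr -sumEFin big_seq [leRHS]big_seq; apply: lee_sum => i si.
rewrite integral_indic//; last exact: measurable_ball_set.
rewrite setIT; exact: time_measure_ball (s0 i si).
Qed.

Lemma interval_count_marginal1 (a b : R) (s : seq (R * R)) (t : R) :
  (forall i, i \in s -> 0 <= i.2) ->
  (\int[time_measure a b]_u (interval_count s (t, u))%:E <=
    (2 * \sum_(i <- s) i.2)%:E)%E.
Proof.
move=> s0; apply: le_trans (integral_ball_count a b (fun i => t - i.1) s0).
rewrite le_eqVlt; apply/orP; left; apply/eqP; apply: eq_integral => u _.
congr (_%:E); apply: eq_bigr => i _; rewrite !indicE; congr (nat_of_bool _)%:R.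
have E : `|t - u - i.1| = `|u - (t - i.1)| by rewrite distrC; congr `|_|; ring.
by apply/idP/idP; rewrite !inE/= E.
Qed.

Lemma interval_count_marginal2 (a b : R) (s : seq (R * R)) (u : R) :
  (forall i, i \in s -> 0 <= i.2) ->
  (\int[time_measure a b]_t (interval_count s (t, u))%:E <=
    (2 * \sum_(i <- s) i.2)%:E)%E.
Proof.
move=> s0; apply: le_trans (integral_ball_count a b (fun i => u + i.1) s0).
rewrite le_eqVlt; apply/orP; left; apply/eqP; apply: eq_integral => t _.
congr (_%:E); apply: eq_bigr => i _; rewrite !indicE; congr (nat_of_bool _)%:R.
have E : `|t - u - i.1| = `|t - (u + i.1)| by congr `|_|; ring.
by apply/idP/idP; rewrite !inE/= E.
Qed.

End time_interval.

(** * The evolution of a function with bounded Fourier support *)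
Section box_characters.
Context {R : realType} (d N : nat).
Local Notation e := (@expi2pi R).

Definition box_char (i : {ffun 'I_d -> 'I_(2 * N).+1}) (x : Rd R d) : R[i] :=
  e (dotZ (box_freq i) x).

Lemma cbounded_box_char i : cbounded (box_char i).
Proof. by apply: cbounded_expi2pi; exact: measurable_linear_form. Qed.

Lemma box_char_orthonormal i j :
  cintegral (torus_measure R d) (fun x => box_char i x * (box_char j x)^*) =
  (i == j)%:R.
Proof.
pose k l : int := tnth (box_freq i) l - tnth (box_freq j) l.
rewrite (_ : (fun x => _) = fun x : Rd R d => e (\sum_l (k l)%:~R * (tnth x l : R))).
  rewrite cintegral_torus_character; congr (nat_of_bool _)%:R.
  apply/forallP/eqP => [k0|ij l]; last by rewrite /k ij subrr.
  apply: (@box_freq_inj d N); apply: eq_from_tnth => l.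
  by apply/eqP; rewrite -subr_eq0; exact: k0.
apply/funext => x; rewrite /box_char -expi2piN -expi2piD; congr e.
rewrite /dotZ -sumrB; apply: eq_bigr => l _.
by rewrite /k intrB mulrBl.
Qed.

Variable f : Rd R d -> R[i].
Hypothesis fL2 : L2_torus f.

Let A : R := fine (cLnorm (torus_measure R d) 2 f).

Lemma L2_torus_normE : cLnorm (torus_measure R d) 2 f = A%:E.
Proof.
by case: fL2 => _ _ foo; rewrite fineK// ge0_fin_numE// /cLnorm Lnorm_ge0.
Qed.

Lemma L2_torus_norm_ge0 : 0 <= A.
Proof. by rewrite fine_ge0// /cLnorm Lnorm_ge0. Qed.

Lemma L2_torus_integralE :
  (\int[torus_measure R d]_x (normc (f x) ^+ 2)%:E = (A ^+ 2)%:E)%E.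
Proof.
have : (cLnorm (torus_measure R d) 2 f `^ 2 = (A ^+ 2)%:E)%E.
  by rewrite L2_torus_normE poweR_EFin powR_mulrn// L2_torus_norm_ge0.
rewrite /cLnorm poweR_Lnorm ?pnatr_eq0// => <-.
apply: eq_integral => x _.
by rewrite abse_EFin ger0_norm ?normc_ge0// poweR_EFin powR_mulrn ?normc_ge0.
Qed.

Lemma sum_fourier_box_le :
  \sum_(i : {ffun 'I_d -> 'I_(2 * N).+1}) normc (fourier f (box_freq i)) ^+ 2 <= A ^+ 2.
Proof.
rewrite -lee_fin -L2_torus_integralE.
have [_ mf _] := fL2.
have := bessel cbounded_box_char box_char_orthonormal mf.
rewrite L2_torus_integralE ltry => /(_ isT).
apply: le_trans; rewrite lee_fin; apply: ler_sum => i _.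
rewrite le_eqVlt; apply/orP; left; apply/eqP; congr (normc _ ^+ 2).
by rewrite /fourier; congr cintegral; apply/funext => x; rewrite expi2piN.
Qed.

(** The coefficients vanish off the box, so that the sum over all frequencies is
    a finite one. *)
Lemma evolution_boxE (alpha : 'I_d -> R) (M t : R) (x : Rd R d) :
  0 <= M -> N = Num.truncn M -> fourier_supp_in f M ->
  evolution alpha f t x = \sum_(i : {ffun 'I_d -> 'I_(2 * N).+1}) fourier f (box_freq i) *
    (e (qform alpha (box_freq i) * t) * box_char i x).
Proof.
move=> M0 NM fM; rewrite /evolution.
pose r := [seq box_freq i | i <- enum {ffun 'I_d -> 'I_(2 * N).+1}].
have ur : uniq r by rewrite map_inj_uniq ?enum_uniq//; exact: box_freq_inj.
rewrite -(@fsbig_widen _ _ _ _ [set` r]%classic); last 2 first.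
- by [].
- move=> n [_ /= nr]; have [f0|f0] := eqVneq (fourier f n) 0; first by rewrite f0 mul0r.
  exfalso; apply: nr; have [|i ->] := @box_freqP d N n.
    move=> j; have := fM n f0 j.
    rewrite -intr_norm -abszE NM => H.
    by rewrite lez_nat truncn_ge_nat.
  by apply/mapP; exists i; rewrite ?mem_enum.
rewrite -fsbig_seq// big_map big_enum/=; apply: eq_bigr => i _.
by rewrite -expi2piD addrC.
Qed.

End box_characters.

Section truncated_evolution.
Context {R : realType} (d N : nat).
Local Notation e := (@expi2pi R).
Variables (alpha : 'I_d -> R) (a b A : R) (c : {ffun 'I_d -> 'I_(2 * N).+1} -> R[i]).
Hypotheses (A0 : 0 < A) (cA : \sum_i normc (c i) ^+ 2 <= A ^+ 2).

Let n : R := (2 * N).+1%:R.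

(** Cutting off the time outside of [[a, b]] makes the kernel vanish unless both
    times lie in the interval, so that it has to be estimated only for
    differences of times bounded by [b - a]. *)
Definition truncated_phase (i : {ffun 'I_d -> 'I_(2 * N).+1}) (t : measurableTypeR R) : R[i] :=
  (\1_([set` `[a, b]%R]%classic : set R) t : R)%:C * e (qform alpha (box_freq i) * t).

Definition truncated_evolution (z : measurableTypeR R * Rd R d) : R[i] :=
  \sum_i c i * (truncated_phase i z.1 * box_char i z.2).

Lemma truncated_phase_le1 i t : normc (truncated_phase i t) <= 1.
Proof.
rewrite normcM normc_expi2pi mulr1 normc_real indicE.
by case: (_ \in _); rewrite ?normr1 ?normr0.
Qed.

Lemma cmeas_truncated_phase i : cmeas (truncated_phase i).
Proof.
apply: cmeasM.
  by case: (@cbounded_indic R _ (measurableTypeR R) _ (measurable_itv `[a, b]%R)).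
by apply: cmeas_expi2pi; exact: measurable_funM.
Qed.

Lemma cbounded_truncated_phase i : cbounded (truncated_phase i).
Proof. by split; [exact: cmeas_truncated_phase|exists 1 => t; exact: truncated_phase_le1]. Qed.

Lemma cbounded_truncated_evolution : cbounded truncated_evolution.
Proof.
apply: cbounded_sum => i; apply: cboundedM; first exact: cbounded_cst.
apply: cboundedM.
  by apply: (@cbounded_fst _ _ _ _ _ (truncated_phase i)); exact: cbounded_truncated_phase.
by apply: (@cbounded_snd _ _ _ _ _ (box_char i)); exact: cbounded_box_char.
Qed.

(** Cauchy-Schwarz, the number of frequencies being [n^d]. *)
Lemma normc_truncated_evolution_le z :
  normc (truncated_evolution z) <= A * n `^ (d%:R / 2).
Proof.
(* The weights below are those for which Cauchy-Schwarz becomes a sum of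
   termwise inequalities of arithmetic and geometric means. *)
pose k := n `^ (d%:R / 2); have n0 : 0 < n by rewrite ltr0n.
have k0 : 0 < k by rewrite powR_gt0.
have k2 : k ^+ 2 = #|{ffun 'I_d -> 'I_(2 * N).+1}|%:R.
  rewrite card_ffun !card_ord natrX -powR_mulrn ?powR_ge0// -powRrM.
  by rewrite divfK ?pnatr_eq0// powR_mulrn// ltW.
apply: le_trans (ler_normc_sum _ _ _) _.
apply: (@le_trans _ _ (\sum_(i : {ffun 'I_d -> 'I_(2 * N).+1})
    (k / (2 * A) * normc (c i) ^+ 2 + A / (2 * k)))).
  apply: ler_sum => i _; rewrite (normcM (c i)) (normcM (truncated_phase i z.1)).
  rewrite {1}/box_char normc_expi2pi mulr1.
  apply: (@le_trans _ _ (normc (c i))).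
    by rewrite ler_piMr ?normc_ge0// truncated_phase_le1.
  set x := normc (c i).
  have : 0 <= k / (2 * A) * (x - A / k) ^+ 2.
    by rewrite mulr_ge0 ?sqr_ge0// divr_ge0 ?mulr_ge0 ?(ltW k0) ?(ltW A0).
  have -> : k / (2 * A) * (x - A / k) ^+ 2 = k / (2 * A) * x ^+ 2 + A / (2 * k) - x.
    by field; rewrite !gt_eqF.
  by rewrite subr_ge0.
rewrite big_split/= -mulr_sumr sumr_const -[X in _ + X]mulr_natr -k2.
have f0 : 0 <= k / (2 * A) by rewrite divr_ge0 ?mulr_ge0 ?(ltW k0) ?(ltW A0).
have H1 := ler_wpM2l f0 cA.
have E1 : k / (2 * A) * A ^+ 2 = A * k / 2 by field; rewrite gt_eqF.
have E2 : A / (2 * k) * k ^+ 2 = A * k / 2 by field; rewrite gt_eqF.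
rewrite E1 in H1; rewrite -/k E2; lra.
Qed.

Lemma truncated_evolutionE z : z.1 \in `[a, b]%R ->
  truncated_evolution z = \sum_i c i * (e (qform alpha (box_freq i) * z.1) * box_char i z.2).
Proof.
move=> zab; apply: eq_bigr => i _; rewrite /truncated_phase indicE.
by rewrite mem_set//= mul1r.
Qed.

(** The intervals [s] are those off which the kernel is at most
    [lam^2 / (2 * A^2)]; the number of them that contain [t - u] is the weight of
    the level set estimate. *)
Lemma truncated_layer_le (L : R) (s : seq (R * R)) (lam : R) :
  0 < lam -> b = a + L -> 0 <= L ->
  (forall i, i \in s -> 0 <= i.2) ->
  (forall t (Y : 'I_d -> R), `|t| <= L ->
    (forall i, i \in s -> i.2 < `|t - i.1|) ->
    normc (\sum_(f : {ffun 'I_d -> 'I_(2 * N).+1})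
      e (\sum_j (tnth (box_freq f) j)%:~R * Y j + qform alpha (box_freq f) * t))
    <= lam ^+ 2 / (2 * A ^+ 2)) ->
  (\int[(time_measure a b \x torus_measure R d)%E]_z
     ((\1_[set z | (lam < normc (truncated_evolution z))%R]%classic z : R) *
       normc (truncated_evolution z) ^+ 2)%:E
   <= (4 * A ^+ 2 * \sum_(i <- s) i.2)%:E)%E.
Proof.
move=> lam0 bE L0 s0 sker.
have A2 : 0 < A ^+ 2 by rewrite exprn_gt0.
have S0 : 0 <= \sum_(i <- s) i.2 by rewrite big_seq; apply: sumr_ge0 => i /s0.
have H0 : 0 <= lam ^+ 2 / (2 * A ^+ 2) by rewrite divr_ge0 ?sqr_ge0// mulr_ge0// ltW.
have -> : 4 * A ^+ 2 * \sum_(i <- s) i.2 = 2 * A ^+ 2 * (2 * \sum_(i <- s) i.2) by ring.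
apply: (@level_set_le R _ _ _ _ (time_measure a b) (torus_measure R d) _
  (@box_char R d N) truncated_phase c (interval_count s) _ (lam ^+ 2 / (2 * A ^+ 2)) A lam).
- exact: cbounded_box_char.
- exact: box_char_orthonormal.
- exact: cmeas_truncated_phase.
- exact: truncated_phase_le1.
- exact: measurable_interval_count.
- exact: interval_count_ge0.
- by move=> t; exact: interval_count_marginal1.
- by move=> t; exact: interval_count_marginal2.
- move=> t u x y /interval_count_lt1 tu.
  pose D : set R := [set` `[a, b]%R]%classic.
  rewrite [X in normc X](_ : _ = ((\1_D t : R) * (\1_D u : R))%:C *
      \sum_(f : {ffun 'I_d -> 'I_(2 * N).+1})
      e (\sum_j (tnth (box_freq f) j)%:~R * ((tnth x j : R) - tnth y j) +
         qform alpha (box_freq f) * (t - u))); last first.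
    rewrite mulr_sumr; apply: eq_bigr => i _.
    have -> : \sum_j (tnth (box_freq i) j)%:~R * ((tnth x j : R) - tnth y j) =
       dotZ (box_freq i) x - dotZ (box_freq i) y.
      by rewrite /dotZ -sumrB; apply: eq_bigr => j _; rewrite mulrBr.
    rewrite /truncated_phase /box_char !conjcM -/D conjc_real -!expi2piN.
    rewrite (_ : dotZ _ x - _ + _ = dotZ (box_freq i) x + - dotZ (box_freq i) y +
      (qform alpha (box_freq i) * t + - (qform alpha (box_freq i) * u))); last by ring.
    by rewrite !expi2piD (rmorphM (real_complex R)) /=; ring.
  rewrite normcM normc_real !indicE.
  case: (boolP (t \in D)) => [|_]; last by rewrite mul0r normr0 mul0r.
  case: (boolP (u \in D)) => [|_]; last by rewrite mulr0 normr0 mul0r.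
  rewrite !inE /D/= !in_itv/= bE => /andP[u1 u2] /andP[t1 t2].
  rewrite mulr1 normr1 mul1r; apply: sker => //.
  by rewrite ler_norml; lra.
- exact: H0.
- by rewrite mulr_ge0.
- exact: cA.
- exact: lam0.
- by rewrite le_eqVlt; apply/orP; left; apply/eqP; field; rewrite gt_eqF.
- exact: A0.
Qed.

End truncated_evolution.

Section truncated_Lp.
Context {R : realType} (d : nat).

(** Take [rho] between 2 and [d * (p - 2) / 4]. The layer at height [lam] contributes
    a multiple of [lam^(p - 2 - 4 * rho / d)] with a positive exponent, and the
    top height is [A * n^(d / 2)]: the powers of [rho] cancel in the result. *)
Lemma truncated_evolution_Lp (C L p : R) : (0 < d)%N -> 1 <= C -> 0 <= L ->
  8 < d%:R * (p - 2) ->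
  exists2 M : R, 0 < M &
    forall (N : nat) (alpha : 'I_d -> R) (a A : R)
      (c : {ffun 'I_d -> 'I_(2 * N).+1} -> R[i]),
    (forall j, C^-1 <= theta alpha j <= C) -> 0 < A ->
    \sum_i normc (c i) ^+ 2 <= A ^+ 2 ->
    (\int[(time_measure a (a + L) \x torus_measure R d)%E]_z
       (normc (truncated_evolution alpha a (a + L) c z) `^ p)%:E <=
     (M * (A `^ p * (2 * N).+1%:R `^ (d%:R / 2 * p - d%:R - 2)))%:E)%E.
Proof.
move=> d0 C1 L0 p8.
have dR : 0 < (d%:R : R) by rewrite ltr0n.
have dn : (d%:R : R) != 0 by rewrite gt_eqF.
(* The midpoint of 2 and [d * (p - 2) / 4]. *)
pose rho := (2 + d%:R * (p - 2) / 4) / 2 : R.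
have rho2 : 2 < rho by rewrite /rho; lra.
have rho4 : 4 * rho < d%:R * (p - 2) by rewrite /rho; lra.
have rho0 : 0 < rho by lra.
pose tau := 4 * rho / d%:R.
have taup : tau < p - 2 by rewrite ltr_pdivrMr// [_ * d%:R]mulrC.
have tau0 : 0 <= tau by rewrite divr_ge0// mulr_ge0// ltW.
have p2 : 2 < p by lra.
have [K K0 cover] := kernel_cover d0 rho2 C1 L0.
pose kap : R := 2 `^ (- (p - 2 - tau)).
have kap1 : 0 < (1 - kap)^-1.
  rewrite invr_gt0 subr_gt0 /kap powRN invf_lt1 ?powR_gt0//.
  rewrite /powR pnatr_eq0/= -[ltLHS]expR0 ltr_expR mulr_gt0 ?subr_gt0//.
  by rewrite ln_gt0 ?ltr1n.
pose M := 2 `^ tau * (4 * K * 2 `^ (2 * rho / d%:R)) * (1 - kap)^-1.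
have M0 : 0 < M by rewrite !mulr_gt0 ?powR_gt0.
exists M => // N alpha a A c th A0 cA.
pose n : R := (2 * N).+1%:R; have n0 : 0 < n by rewrite ltr0n.
have A2 : 0 < A ^+ 2 by rewrite exprn_gt0.
pose g z := normc (truncated_evolution alpha a (a + L) c z).
pose La := A * n `^ (d%:R / 2).
have La0 : 0 < La by rewrite mulr_gt0 ?powR_gt0.
pose Q := 4 * A ^+ 2 * (K * ((2 * A ^+ 2) `^ (2 * rho / d%:R) * n `^ (2 * rho - 2))).
have Q0 : 0 <= Q.
  apply: mulr_ge0; first by rewrite mulr_ge0// ltW.
  by apply: mulr_ge0; [exact: ltW|rewrite mulr_ge0 ?powR_ge0].
have sqrE (x y : R) : 0 < x -> (x ^+ 2) `^ y = x `^ (2 * y).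
  by move=> x0; rewrite -powR_mulrn ?(ltW x0)// -powRrM.
have powRDp (x y z : R) : 0 < x -> x `^ y * x `^ z = x `^ (y + z).
  by move=> x0; rewrite powRD//; apply/implyP => _; rewrite gt_eqF.
have layer l : 0 < l -> (\int[(time_measure a (a + L) \x torus_measure R d)%E]_z
     ((\1_[set z | (l < g z)%R]%classic z : R) * g z ^+ 2)%:E
   <= (Q * l `^ (- tau))%:E)%E.
  move=> l0; have H0 : 0 < l ^+ 2 / (2 * A ^+ 2) by rewrite divr_gt0 ?exprn_gt0 ?mulr_gt0.
  have [s [s0 sK ker]] := cover N alpha _ th H0.
  have := @truncated_layer_le R d N alpha a (a + L) A c A0 cA L s l l0 erefl L0 s0 ker.
  move/le_trans; apply.
  rewrite lee_fin /Q -[leRHS]mulrA ler_pM2l ?mulr_gt0//.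
  apply: le_trans sK _; rewrite -[leRHS]mulrA ler_pM2l//.
  have -> : (l ^+ 2 / (2 * A ^+ 2)) `^ (- (2 * rho / d%:R)) =
      (2 * A ^+ 2) `^ (2 * rho / d%:R) * l `^ (- tau).
    rewrite [LHS]powRM; [|exact: sqr_ge0|by rewrite invr_ge0 mulr_ge0// ltW].
    have A22 : 0 <= 2 * A ^+ 2 by rewrite mulr_ge0// ltW.
    rewrite (powR_invE _ A22) opprK (sqrE l)// mulrC; congr (_ * _ `^ _).
    by rewrite /tau; field.
  by rewrite le_eqVlt; apply/orP; left; apply/eqP; rewrite /n; ring.
have bt := cbounded_truncated_evolution alpha a (a + L) c.
have := @dyadic_layers_le R _ _ (time_measure a (a + L) \x torus_measure R d)%E
  g (p - 2) tau La Q (product_measure_lty _ _) (cmeas_normc bt.1)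
  (fun z => normc_ge0 _) (normc_truncated_evolution_le alpha a (a + L) A0 cA) La0 tau0 taup Q0
  layer.
rewrite subrK; move/le_trans; apply; rewrite lee_fin le_eqVlt; apply/orP; left; apply/eqP.
have E1 : La `^ (p - 2 - tau) =
    A `^ (p - 2 - tau) * n `^ (d%:R / 2 * (p - 2 - tau)).
  by rewrite /La [LHS]powRM; [rewrite -powRrM|exact: ltW|exact: powR_ge0].
have E2 : (2 * A ^+ 2) `^ (2 * rho / d%:R) =
    2 `^ (2 * rho / d%:R) * A `^ (2 * (2 * rho / d%:R)).
  by rewrite [LHS]powRM; [rewrite sqrE|by []|exact: ltW].
rewrite -/kap E1 /M /Q E2.
have -> : A ^+ 2 = A `^ 2 by rewrite powR_mulrn// ltW.
have -> : A `^ p = A `^ 2 * A `^ (2 * (2 * rho / d%:R)) * A `^ (p - 2 - tau).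
  by rewrite !powRDp//; congr powR; rewrite /tau; field.
rewrite -/n; have -> : n `^ (d%:R / 2 * p - d%:R - 2) =
    n `^ (2 * rho - 2) * n `^ (d%:R / 2 * (p - 2 - tau)).
  by rewrite powRDp//; congr powR; rewrite /tau; field.
by ring.
Qed.

End truncated_Lp.

(** * Strichartz estimates *)
Section strichartz_estimates.
Context {R : realType} (d : nat).

(** The estimate [strichartz] without roots, where the integral of the [p]-th
    power may be split and compared. *)
Definition strichartz_integral (C L p s : R) : Prop :=
  exists2 M : R, 0 < M &
    forall alpha : 'I_d -> R, (forall j, C^-1 <= theta alpha j <= C) ->
    forall a N : R, 1 <= N ->
    forall f : Rd R d -> R[i], L2_torus f -> fourier_supp_in f N ->
      (\int[(time_measure a (a + L) \x torus_measure R d)%E]_z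
         (normc (evolution alpha f z.1 z.2) `^ p)%:E <=
       (M * (fine (cLnorm (torus_measure R d) 2 f) * N `^ s) `^ p)%:E)%E.

Lemma measurable_normc_evolution (alpha : 'I_d -> R) (N : R) (f : Rd R d -> R[i]) :
  0 <= N -> fourier_supp_in f N ->
  measurable_fun [set: measurableTypeR R * Rd R d]
    (fun z => normc (evolution alpha f z.1 z.2)).
Proof.
move=> N0 fN.
under eq_fun do rewrite (@evolution_boxE _ _ (Num.truncn N) f alpha N _ _ N0 erefl fN).
apply: cmeas_normc; apply: cmeas_sum => i; apply: cmeasM; first exact: cmeas_cst.
apply: cmeasM.
  have mQ : measurable_fun [set: measurableTypeR R] (fun t : R => qform alpha (box_freq i) * t).
    exact: measurable_funM.
  by case: (@cbounded_fst R _ _ _ (Rd R d) _ (cbounded_expi2pi mQ)).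
by case: (@cbounded_snd R _ _ (measurableTypeR R) _ _ (cbounded_box_char i)).
Qed.

Lemma evolution_eq0 (alpha : 'I_d -> R) (N t : R) (x : Rd R d) (f : Rd R d -> R[i]) :
  0 <= N -> L2_torus f -> fourier_supp_in f N ->
  fine (cLnorm (torus_measure R d) 2 f) = 0 -> evolution alpha f t x = 0.
Proof.
move=> N0 fL2 fN A00; pose m := Num.truncn N.
rewrite (@evolution_boxE _ _ m f alpha N _ _ N0 erefl fN) big1// => i _.
have : normc (fourier f (box_freq (N := m) i)) ^+ 2 <= 0.
  apply: (@le_trans _ _ (fine (cLnorm (torus_measure R d) 2 f) ^+ 2)); last by rewrite A00 expr0n.
  apply: le_trans (sum_fourier_box_le m fL2).
  by rewrite (bigD1 i)//= lerDl; apply: sumr_ge0 => j _; exact: sqr_ge0.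
move=> H; have : normc (fourier f (box_freq (N := m) i)) ^+ 2 = 0.
  by apply/eqP; rewrite eq_le H sqr_ge0.
by move/eqP; rewrite sqrf_eq0 => /eqP /Normc.eq0_normc ->; rewrite mul0r.
Qed.

Lemma strichartz_integral_scaling (C L p : R) : (0 < d)%N -> 1 <= C -> 0 <= L ->
  8 < d%:R * (p - 2) ->
  strichartz_integral C L p (d%:R / 2 - (d%:R + 2) / p).
Proof.
move=> d0 C1 L0 p8; have [M M0 HM] := truncated_evolution_Lp d0 C1 L0 p8.
have dR : 0 < (d%:R : R) by rewrite ltr0n.
have p2 : 2 < p by rewrite -subr_gt0 -(pmulr_rgt0 _ dR); lra.
have p0 : p != 0 by rewrite gt_eqF//; lra.
pose e' := d%:R / 2 * p - d%:R - 2 : R.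
have e'0 : 0 <= e' by rewrite /e'; lra.
exists (M * 3 `^ e') => [|alpha th a N N1 f fL2 fN]; first by rewrite mulr_gt0 ?powR_gt0.
have N0 : 0 <= N by lra.
set A := fine _; have A0 : 0 <= A := L2_torus_norm_ge0 f.
pose m := Num.truncn N.
have evE := @evolution_boxE _ _ m f alpha N _ _ N0 erefl fN.
have cA : \sum_i normc (fourier f (box_freq (N := m) i)) ^+ 2 <= A ^+ 2 by exact: sum_fourier_box_le.
have [A00|An0] := eqVneq A 0.
  rewrite [leLHS](_ : _ = 0%E).
    by rewrite lee_fin mulr_ge0 ?powR_ge0// mulr_ge0 ?powR_ge0// ltW.
  apply: integral0_eq => z _.
  by rewrite (evolution_eq0 _ _ _ N0 fL2 fN A00) Normc.normc0 powR0.
have Ap : 0 < A by rewrite lt_def An0.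
have := HM m alpha a A (fun i => fourier f (box_freq i)) th Ap cA.
set c := fun i => fourier f (box_freq i).
have -> : (\int[(time_measure a (a + L) \x torus_measure R d)%E]_z
    (normc (evolution alpha f z.1 z.2) `^ p)%:E =
   \int[(time_measure a (a + L) \x torus_measure R d)%E]_z
    (normc (truncated_evolution alpha a (a + L) c z) `^ p)%:E)%E.
  apply: ge0_ae_eq_integral => //.
  - apply/measurable_EFinP; apply: (measurableT_comp (measurable_powR p)).
    exact: measurable_normc_evolution N0 fN.
  - apply/measurable_EFinP; apply: (measurableT_comp (measurable_powR p)).
    by apply: cmeas_normc; case: (cbounded_truncated_evolution alpha a (a + L) c).
  - by move=> z _; rewrite lee_fin powR_ge0.
  - by move=> z _; rewrite lee_fin powR_ge0.
  - pose D : set (measurableTypeR R) := [set` `[a, a + L]%R]%classic.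
    have mD : measurable D by exact: measurable_itv.
    exists ((~` D) `*` setT)%classic; split.
    + by apply: measurableX => //; exact: measurableC.
    + transitivity (time_measure a (a + L) (~` D)%classic *
          torus_measure R d [set: Rd R d]%classic)%E.
        by apply: product_measure1E => //; exact: measurableC.
      rewrite (_ : time_measure _ _ _ = 0%E) ?mul0e//.
      by rewrite /time_measure /mrestr setICl measure0.
    + move=> z /= nz; split => //= zD; apply: nz => _.
      by rewrite evE truncated_evolutionE.
move/le_trans; apply; rewrite lee_fin -[leRHS]mulrA ler_pM2l//.
have n3 : (2 * m).+1%:R <= 3 * N :> R.
  have : m%:R <= N by rewrite truncn_le.
  by rewrite -natr1 natrM; lra.
have -> : (A * N `^ (d%:R / 2 - (d%:R + 2) / p)) `^ p = A `^ p * N `^ e'.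
  rewrite powRM ?powR_ge0// -powRrM; congr (_ * _ `^ _).
  by rewrite /e'; field.
rewrite mulrCA ler_wpM2l ?powR_ge0// -powRM//.
by apply: ge0_ler_powR; rewrite ?nnegrE// mulr_ge0.
Qed.

Lemma strichartz_integral_le_exponent (C L p s s' : R) :
  0 < p -> s <= s' -> strichartz_integral C L p s -> strichartz_integral C L p s'.
Proof.
move=> p0 ss [M M0 HM]; exists M; first exact: M0.
move=> alpha th a N N1 f fL2 fN.
apply: le_trans (HM alpha th a N N1 f fL2 fN) _.
rewrite lee_fin (ler_pM2l M0); apply: ge0_ler_powR.
- exact: ltW.
- by rewrite nnegrE mulr_ge0 ?powR_ge0 ?L2_torus_norm_ge0.
- by rewrite nnegrE mulr_ge0 ?powR_ge0 ?L2_torus_norm_ge0.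
- by rewrite ler_wpM2l ?L2_torus_norm_ge0// ler_powR.
Qed.

(** The measure of space-time is at most [L]. With [k] the bound of the [L^q] norm,
    split according to whether the function exceeds [k]. *)
Lemma strichartz_integral_lower_p (C L p q s : R) : 0 <= L ->
  0 < p -> p <= q -> strichartz_integral C L q s -> strichartz_integral C L p s.
Proof.
move=> L0 p0 pq [M M0 HM]; exists (L + 1 + M); first by rewrite addr_gt0// ltr_wpDl.
move=> alpha th a N N1 f fL2 fN.
have N0 : 0 <= N by lra.
have HM' := HM alpha th a N N1 f fL2 fN.
set A := fine _ in HM' *; set k := A * N `^ s in HM' *.
have A0 : 0 <= A := L2_torus_norm_ge0 f.
have [A00|An0] := eqVneq A 0.
  rewrite [leLHS](_ : _ = 0%E).
    rewrite lee_fin; apply: mulr_ge0; last exact: powR_ge0.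
    by apply: addr_ge0; [apply: addr_ge0|exact: ltW].
  apply: integral0_eq => z _.
  by rewrite (evolution_eq0 _ _ _ N0 fL2 fN A00) Normc.normc0 powR0// gt_eqF.
have k0 : 0 < k by apply: mulr_gt0; [rewrite lt_def An0|apply: powR_gt0; lra].
pose g (z : measurableTypeR R * Rd R d) := normc (evolution alpha f z.1 z.2).
have mg : measurable_fun [set: measurableTypeR R * Rd R d]%classic g.
  exact: measurable_normc_evolution N0 fN.
have mgr r : measurable_fun [set: measurableTypeR R * Rd R d]%classic (fun z => g z `^ r).
  exact: (measurableT_comp (measurable_powR r)).
have split_le y : 0 <= y -> y `^ p <= k `^ p + k `^ (p - q) * y `^ q.
  move=> y0; have [yk|ky] := leP y k.
    apply: (@le_trans _ _ (k `^ p)); last by rewrite lerDl mulr_ge0 ?powR_ge0.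
    by apply: ge0_ler_powR; rewrite ?nnegrE ?(ltW p0) ?(ltW k0).
  have yp : 0 < y by rewrite (lt_trans k0).
  apply: (@le_trans _ _ (k `^ (p - q) * y `^ q)); last by rewrite lerDr powR_ge0.
  have -> : y `^ p = y `^ (p - q) * y `^ q.
    by rewrite -powRD ?subrK//; apply/implyP => _; rewrite gt_eqF.
  rewrite ler_wpM2r ?powR_ge0//.
  rewrite -[p - q]opprB !powRN lef_pV2 ?posrE ?powR_gt0//.
  by apply: ge0_ler_powR; rewrite ?subr_ge0 ?nnegrE ?(ltW k0) ?(ltW ky).
apply: (@le_trans _ _ (\int[(time_measure a (a + L) \x torus_measure R d)%E]_z
   ((k `^ p)%:E + (k `^ (p - q) * g z `^ q)%:E))%E).
  apply: ge0_le_integral; first exact: measurableT.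
  - by move=> z _; rewrite lee_fin powR_ge0.
  - by apply/measurable_EFinP; exact: mgr.
  - apply: emeasurable_funD; first exact: measurable_cst.
    by apply/measurable_EFinP; apply: measurable_funM => //; exact: mgr.
  - by move=> z _; rewrite -EFinD lee_fin; apply: split_le; exact: normc_ge0.
rewrite ge0_integralD//; last 3 first.
- by move=> z _; rewrite lee_fin powR_ge0.
- by move=> z _; rewrite lee_fin mulr_ge0 ?powR_ge0.
- by apply/measurable_EFinP; apply: measurable_funM => //; exact: mgr.
rewrite ge0_integralZl_real ?powR_ge0//; last first.
  by move=> z; exact: powR_ge0.
rewrite integral_cst//.
have mT : ((time_measure a (a + L) \x torus_measure R d)%E
    [set: measurableTypeR R * Rd R d]%classic <= L%:E)%E.
  rewrite -setXTT.
  apply: (@le_trans _ _ (time_measure a (a + L) [set: measurableTypeR R]%classic *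
          torus_measure R d [set: Rd R d]%classic)%E).
    by rewrite le_eqVlt; apply/orP; left; apply/eqP; exact: product_measure1E.
  rewrite [X in (_ * X)%E](_ : _ = 1%E) ?mule1; last exact: probability_setT.
  rewrite /time_measure /mrestr setTI lebesgue_measure_itv/=.
  by case: ifP => _; [rewrite -EFinB lee_fin; lra|rewrite lee_fin].
apply: (@le_trans _ _ ((k `^ p)%:E * L%:E + (k `^ (p - q))%:E * (M * k `^ q)%:E)%E).
  by apply: leeD; apply: lee_wpmul2l; rewrite ?lee_fin ?powR_ge0.
rewrite -!EFinM -EFinD lee_fin.
have -> : k `^ (p - q) * (M * k `^ q) = M * k `^ p.
  rewrite mulrCA -powRD ?subrK//; apply/implyP => _; by rewrite gt_eqF.
by have := powR_ge0 k p; lra.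
Qed.

Lemma strichartz_of_integral (C L p s : R) : 0 < p ->
  strichartz_integral C L p s -> strichartz d C L p s.
Proof.
move=> p0 [M M0 HM]; exists (M `^ p^-1); first exact: powR_gt0.
move=> alpha _ th a N N1 f fL2 fN.
have HM' := HM alpha th a N N1 f fL2 fN.
rewrite (L2_torus_normE fL2).
set A := fine _ in HM' *; have A0 : 0 <= A := L2_torus_norm_ge0 f.
have k0 : 0 <= A * N `^ s by rewrite mulr_ge0 ?powR_ge0.
have pn0 : p != 0 by rewrite gt_eqF.
rewrite -EFinM.
have -> : M `^ p^-1 * N `^ s * A = (M * (A * N `^ s) `^ p) `^ p^-1.
  rewrite powRM ?powR_ge0 ?(ltW M0)// -powRrM mulfV// powRr1//; ring.
rewrite /cLnorm unlock -poweR_EFin.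
apply: gt0_ler_poweR; first by rewrite invr_ge0 ltW.
- rewrite in_itv; apply/andP; split; last exact: leey.
  by apply: integral_ge0 => z _; exact: poweR_ge0.
- by rewrite in_itv/= leey andbT lee_fin mulr_ge0 ?powR_ge0// ltW.
- apply: le_trans HM'; rewrite le_eqVlt; apply/orP; left; apply/eqP.
  apply: eq_integral => z _.
  by rewrite abse_EFin ger0_norm ?normc_ge0// poweR_EFin.
Qed.

End strichartz_estimates.

Theorem theorem1p2 (R : realType) (d : nat) (C L : R) :
  (2 <= d)%N -> 1 <= C -> 0 <= L ->
  (forall p : R,
     [\/ d = 2%N /\ 20 / 3 < p,
         d = 3%N /\ 16 / 3 < p,
         d = 4%N /\ 4 < p
       | (5 <= d)%N /\ 4 <= p] ->
     strichartz d C L p (d%:R / 2 - (d%:R + 2) / p)) /\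
  (forall eps p : R, 0 < eps ->
     [\/ d = 2%N /\ 20 / 3 <= p,
         d = 3%N /\ p = 16 / 3
       | d = 4%N /\ p = 4] ->
     strichartz d C L p (d%:R / 2 - (d%:R + 2) / p + eps)).
Proof.
move=> d2 C1 L0; have d0 : (0 < d)%N by rewrite ltnW.
have scaling (p : R) : 0 < p -> 8 < d%:R * (p - 2) ->
    strichartz_integral d C L p (d%:R / 2 - (d%:R + 2) / p).
  by move=> p0 p8; exact: strichartz_integral_scaling.
have lossy (p eps : R) : 0 < p -> 0 < eps -> 8 < d%:R * (p - 2) ->
    strichartz d C L p (d%:R / 2 - (d%:R + 2) / p + eps).
  move=> p0 e0 p8; apply: strichartz_of_integral => //.
  apply: strichartz_integral_le_exponent (scaling p p0 p8) => //.
  by rewrite lerDl ltW.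
split => [p|eps p e0].
- move=> pd; suff [p0 p8] : 0 < p /\ 8 < d%:R * (p - 2).
    exact: strichartz_of_integral (scaling p p0 p8).
  case: pd => [[-> p1]|[-> p1]|[-> p1]|[d5 p1]]; split; try lra.
  have : (5%:R : R) <= d%:R by rewrite ler_nat.
  by move=> d5R; nra.
- case=> [[dE p1]|[dE p1]|[dE p1]].
  + by apply: lossy => //; rewrite ?dE; lra.
  + by apply: lossy => //; rewrite ?dE; lra.
  (* Here [d * (p - 2) = 8] is the excluded endpoint. The exponents at [4] and at
     [4 + eps] differ by less than [eps]. *)
  + have q0 : 0 < 4 + eps by lra.
    have q8 : 8 < d%:R * (4 + eps - 2) by rewrite dE; lra.
    apply: strichartz_of_integral; first by rewrite p1.
    apply: (strichartz_integral_lower_p (q := 4 + eps)) => //; [by rewrite p1| |].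
      by rewrite p1; lra.
    apply: strichartz_integral_le_exponent (scaling _ q0 q8) => //.
    rewrite dE p1 -subr_ge0.
    have -> : 4 / 2 - (4 + 2) / 4 + eps - (4 / 2 - (4 + 2) / (4 + eps)) =
      eps * (4 * eps + 10) / (4 * (4 + eps)).
      by field; rewrite gt_eqF.
    by rewrite divr_ge0// mulr_ge0//; lra.
Qed.
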